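(* Let $L,T,\delta\in(0,\infty)$, $\Theta=\bigcup_{k\in\mathbb N}\mathbb Z^k$, and let $f\in C(\mathbb R,\mathbb R)$ satisfy $|f(a)-f(b)|\le L|a-b|$ for all $a,b\in\mathbb R$. Let $(\Omega,\mathcal F,\mathbb P)$ be a probability space, let $R^\theta\colon\Omega\to(0,1)$, $\theta\in\Theta$, be i.i.d. random variables with $\mathbb P(R^0\le t)=t$ for all $t\in(0,1)$, let $W^{d,\theta}\colon[0,T]\times\Omega\to\mathbb R^d$, $d\in\mathbb N$, $\theta\in\Theta$, be independent processes such that each $W^{d,\theta}$ is a standard ($d$-dimensional) Brownian motion, and assume that $(R^\theta)_{\theta\in\Theta}$ and $(W^{d,\theta})_{(d,\theta)\in\mathbb N\times\Theta}$ are independent. Let $v^{d,K}_k\in C(\mathbb R^d,\mathbb R)$, $k\in\{0,1,\dots,K\}$, $d,K\in\mathbb N$, satisfy for all $d,K\in\mathbb N$, $k\in\{1,2,\dots,K\}$, $x\in\mathbb R^d$ that $|v^{d,K}_0(x)|\le L$ and $$v^{d,K}_k(x)=\mathbb E\Big[v^{d,K}_{k-1}(x+W^{d,0}_{T/K})+\tfrac TK f\big(v^{d,K}_{k-1}(x+W^{d,0}_{T/K})\big)\Big].$$ Let $V^{d,K,\theta}_{k,n,M}\colon\mathbb R^d\times\Omega\to\mathbb R$, $\theta\in\Theta$, $k\in\{0,1,\dots,K\}$, $n\in\mathbb N_0$, $d,K,M\in\mathbb N$, satisfy for all $d,K,M\in\mathbb N$, $n\in\mathbb N_0$, $k\in\{0,1,\dots,K\}$,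 $\theta\in\Theta$, $x\in\mathbb R^d$ that $$\begin{aligned}V^{d,K,\theta}_{k,n,M}(x)&=\frac{\mathbb 1_{\mathbb N}(n)}{M^n}\sum_{m=1}^{M^n}\Big[v^{d,K}_0\big(x+W^{d,(\theta,0,-m)}_{kT/K}\big)+\tfrac{kT}{K}f(0)\Big]\\&\quad+\sum_{j=1}^{n-1}\frac{kT}{KM^{n-j}}\sum_{m=1}^{M^{n-j}}\bigg[f\Big(V^{d,K,(\theta,j,m)}_{\lfloor kR^{(\theta,j,m)}\rfloor,j,M}\big(x+W^{d,(\theta,j,m)}_{kT/K}-W^{d,(\theta,j,m)}_{\lfloor kR^{(\theta,j,m)}\rfloor T/K}\big)\Big)\\&\qquad\qquad-f\Big(V^{d,K,(\theta,j,-m)}_{\lfloor kR^{(\theta,j,m)}\rfloor,j-1,M}\big(x+W^{d,(\theta,j,m)}_{kT/K}-W^{d,(\theta,j,m)}_{\lfloor kR^{(\theta,j,m)}\rfloor T/K}\big)\Big)\bigg].\end{aligned}$$ For every $d,K,M\in\mathbb N$, $n\in\mathbb N_0$ let $\mathfrak C^{d,K}_{M,n}\in\mathbb N_0$ be the number of realizations of scalar standard normal random variables which are used to compute one realization of $V^{d,K,0}_{K,n,M}(0)\colon\Omega\to\mathbb R$, in the precise sense that for all $d,K,M\in\mathbb N$, $n\in\mathbb N_0$ $$\mathfrak C^{d,K}_{M,n}\le dM^n+\sum_{j=1}^{n-1}M^{n-j}\big(d+1+\mathfrak C^{d,K}_{M,j}+\mathfrak C^{d,K}_{M,j-1}\big)\quad\text{if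 }n\ge1,\qquad \mathfrak C^{d,K}_{M,0}\le d.$$ Then there exist $\mathfrak N=(\mathfrak N_\varepsilon)_{\varepsilon\in(0,1]}\colon(0,1]\to\mathbb N$ and $\mathfrak c\in\mathbb R$ such that for all $\varepsilon\in(0,1]$, $d,K\in\mathbb N$ it holds that $$\mathfrak C^{d,K}_{\mathfrak N_\varepsilon,\mathfrak N_\varepsilon}\le\mathfrak c\,d\,\varepsilon^{-(2+\delta)}\qquad\text{and}\qquad\Big(\mathbb E\big[|V^{d,K,0}_{K,\mathfrak N_\varepsilon,\mathfrak N_\varepsilon}(0)-v^{d,K}_K(0)|^2\big]\Big)^{1/2}\le\varepsilon.$$
   Context: $\mathbb N=\{1,2,3,\dots\}$, $\mathbb N_0=\mathbb N\cup\{0\}$; $\lfloor t\rfloor=\max((-\infty,t]\cap\mathbb Z)$. $\mathbb 1_{\mathbb N}$ is the indicator function of $\mathbb N$. Elements of $\Theta=\bigcup_{k\in\mathbb N}\mathbb Z^k$ are finite tuples of integers; integers are identified with elements of $\mathbb Z^1\subseteq\Theta$ (so $0\in\Theta$), and for $\theta\in\mathbb Z^k$ and $j,m\in\mathbb Z$ the symbol $(\theta,j,m)\in\mathbb Z^{k+2}$ denotes the tuple obtained by appending $j$ and $m$ to $\theta$. Empty sums are $0$; in particular $V^{d,K,\theta}_{k,0,M}=0$. *)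

(* Defs.v *)
From mathcomp Require Import all_boot all_order all_algebra.
From mathcomp Require Import all_classical all_reals all_analysis.
Set Implicit Arguments.
Unset Strict Implicit.
Unset Printing Implicit Defensive.
Import Order.TTheory GRing.Theory Num.Theory.
Import numFieldNormedType.Exports.
Local Open Scope classical_set_scope.
Local Open Scope ring_scope.

(* The union of the Z^k over k >= 1 is the type of nonempty finite sequences
   of integers. *)
Definition Theta : Type := {s : seq int | s != [::]}.

(* The integer 0, seen as the 1-tuple (0). *)
Definition theta0 : Theta := exist _ [:: 0] isT.

Lemma append2_subproof (theta : Theta) (j m : int) :
  val theta ++ [:: j; m] != [::].
Proof. by case: theta => -[|a s]. Qed.

Definition append2 (theta : Theta) (j m : int) : Theta :=
  exist _ (val theta ++ [:: j; m]) (append2_subproof theta j m).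

(* The sigma-algebra generated by the real random variables X i, i in D. *)
Definition sigma_rv (R : realType) (Omega I : Type) (D : set I)
    (X : I -> Omega -> R) : set_system Omega :=
  <<s \bigcup_(i in D) preimage_set_system [set: Omega] (X i) measurable >>.

(* On R^d the Borel sigma-algebra is generated by the coordinates, so random
   vectors are handled through their coordinates. *)
Definition sigma_rvec (R : realType) (Omega : Type) (d : nat)
    (X : Omega -> 'rV[R]_d) : set_system Omega :=
  sigma_rv [set: 'I_d] (fun i w => X w 0 i).

Definition sigma_process (R : realType) (Omega : Type) (d : nat) (T : R)
    (X : R -> Omega -> 'rV[R]_d) : set_system Omega :=
  sigma_rv [set ti : R * 'I_d | 0 <= ti.1 <= T]
    (fun ti w => X ti.1 w 0 ti.2).

Section independence.
Context (disp : measure_display) (Omega : measurableType disp) (R : realType).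
Variable P : probability Omega R.

Definition independent2 (G H : set_system Omega) : Prop :=
  forall A B, G A -> H B -> P (A `&` B) = (P A * P B)%E.

Definition mutually_independent (I : choiceType) (D : set I)
    (G : I -> set_system Omega) : Prop :=
  forall s : seq I, uniq s -> (forall i, i \in s -> D i) ->
  forall A : I -> set Omega, (forall i, i \in s -> G i (A i)) ->
  P (\bigcap_(i in [set` s]) A i) = (\prod_(i <- s) P (A i))%E.

(* The law of X is N(0, sigma^2 I_d), for sigma <> 0; the second argument of
   normal_prob is the standard deviation. *)
Definition is_isotropic_normal (d : nat) (sigma : R)
    (X : Omega -> 'rV[R]_d) : Prop :=
  mutually_independent [set: 'I_d]
    (fun i => sigma_rv [set: unit] (fun _ w => X w 0 i)) /\
  forall (i : 'I_d) (B : set R), measurable B ->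
    P [set w | B (X w 0 i)] = normal_prob 0 sigma B.

Record is_brownian_motion (d : nat) (T : R) (W : R -> Omega -> 'rV[R]_d)
    : Prop := {
  brownian_measurable : forall (t : R) (i : 'I_d), 0 <= t <= T ->
    measurable_fun [set: Omega] (fun w => W t w 0 i);
  brownian_start : {ae P, forall w, W 0 w = 0};
  brownian_continuous :
    {ae P, forall w, {within `[0, T], continuous (fun t => W t w)}};
  brownian_independent_increments : forall (n : nat) (t : nat -> R),
    (forall i, (i <= n)%N -> 0 <= t i <= T) ->
    (forall i, (i < n)%N -> t i <= t i.+1) ->
    mutually_independent [set i | (i < n)%N]
      (fun i => sigma_rvec (fun w => W (t i.+1) w - W (t i) w));
  brownian_normal_increments : forall s t : R, 0 <= s -> s < t -> t <= T ->
    is_isotropic_normal (Num.sqrt (t - s)) (fun w => W t w - W s w)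
}.

End independence.

(* Main.v *)
(* Write h = T / K. Conditionally on the sources of randomness attached to
   (theta, j, m), the recursion is driven by independent copies of the scheme, so
   its mean telescopes to that of one Picard step applied to the level n - 1, and
   its variance is the sum of the variances of the samples. With the Feynman-Kac
   representation of v_k this gives, for the mean square errors e(n, k),
     e(n, k) <= c / M^n + C h (sum_(i < k) (e(n - 1, i)
                + sum_(1 <= j < n) M^(j - n) (e(j, i) + e(j - 1, i)))).
   Measured in units of (1 + M h)^k, every sum over time steps gains a factor
   1 / M, and induction on n yields e(n, k) <= A q^n M^(-n) (1 + M h)^k with A and
   q independent of d and K. For M = n this is at most A (q e^T / n)^n, while the
   cost is at most d (5 n)^n; for the least n reaching the accuracy eps, failure
   at n - 1 bounds the cost by a multiple of d eps^-(2 + delta). *)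
Require Import Defs.
From mathcomp Require Import all_boot all_order all_algebra.
From mathcomp Require Import all_classical all_reals all_analysis.
From mathcomp Require Import measurable_realfun ring lra zify.
Set Implicit Arguments.
Unset Strict Implicit.
Unset Printing Implicit Defensive.
Import Order.TTheory GRing.Theory Num.Theory.
Import numFieldNormedType.Exports.
Local Open Scope classical_set_scope.
Local Open Scope ring_scope.

(** * Independence *)

(** No conditional expectation is formed. A sub-sigma-algebra is a measurable type of its own on the
    points of [Omega], and independence of two of them says that the diagonal map sends [P] to a
    product measure; conditioning on some sources is then Fubini's theorem ([freezing]). The price
    is that each random field has to be jointly measurable in the space point and in the sources
    that it uses. The index tuples form a tree: [V theta] lives on the strict extensions of [theta],
    and distinct samples live on disjoint subtrees. For fixed parameters all variables are bounded,
    since [v 0] is bounded and [f] is Lipschitz, so integrability is never an issue. Only the bound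
    on [v] enters the estimates, and it is uniform in d and K. The random time level is split into
    its finitely many values. Once the level and the space point are frozen, the two approximations
    inside a correction are independent, so that comparing the laws of [V] at single points
    suffices. In the error recursion, the factor 1 / M gained from the time sum is what compensates
    for the appearance of level j - 1 beside level j. *)

Section independence_lemmas.
Context (disp : measure_display) (Omega : measurableType disp) (R : realType).
Variable P : probability Omega R.

Lemma independent2_sym (G H : set_system Omega) :
  independent2 P G H -> independent2 P H G.
Proof. by move=> GH A B HA GB; rewrite setIC muleC; exact: GH. Qed.

Lemma independent2_sub (G H G' H' : set_system Omega) :
  G' `<=` G -> H' `<=` H -> independent2 P G H -> independent2 P G' H'.
Proof. by move=> GG HH GH A B /GG GA /HH HB; exact: GH. Qed.

(** For fixed [B] in [H], the finite measures P(. & B) and P(.) P(B) agree on the pi-system [G],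
    hence on the sigma-algebra that it generates. *)
Lemma independent2_g_sigmal (G H : set_system Omega) :
  G `<=` measurable -> H `<=` measurable -> setI_closed G -> G setT ->
  independent2 P G H -> independent2 P <<s G >> H.
Proof.
move=> Gm Hm GI GT GH A B sGA HB.
have mB : measurable B by exact: Hm.
have PB0 : 0 <= fine (P B) by rewrite fine_ge0.
pose m1 := mrestr P mB.
pose m2 := mscale (NngNum PB0) P.
have PBE : (fine (P B))%:E = P B by rewrite fineK // fin_num_measure.
have m2E X : m2 X = (P X * P B)%E by rewrite /m2 /mscale /= PBE muleC.
rewrite -m2E -[LHS]/(m1 A).
apply: (g_sigma_algebra_measure_unique G Gm (fun _ : nat => setT)) => //.
- by apply/seteqP; split => // x _; exists 0%N.
- by move=> C GC; rewrite /= -/(m2 C) m2E; exact: GH.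
- by move=> _; rewrite -[ltLHS]/(P (setT `&` B)) setTI (le_lt_trans (probability_le1 P mB)) ?ltry.
Qed.

Lemma independent2_g_sigma (G H : set_system Omega) :
  G `<=` measurable -> H `<=` measurable -> setI_closed G -> setI_closed H ->
  G setT -> H setT ->
  independent2 P G H -> independent2 P <<s G >> <<s H >>.
Proof.
move=> Gm Hm GI HI GT HT GH.
apply: independent2_g_sigmal => //.
  by apply: smallest_sub => //; exact: sigma_algebra_measurable.
by apply: independent2_sym; apply: independent2_g_sigmal => //; exact: independent2_sym.
Qed.

Section grouping.
Context (I : choiceType) (G : I -> set_system Omega).
Hypothesis sG : forall i, sigma_algebra setT (G i).
Hypothesis Gm : forall i, G i `<=` measurable.

(** Unlike the union of the [G i], these finite intersections form a pi-system, and they generate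
    the same sigma-algebra. *)
Definition fin_inter (D : set I) : set_system Omega :=
  [set A | exists s : seq I, exists B : I -> set Omega,
    [/\ uniq s, forall i, i \in s -> D i, forall i, i \in s -> G i (B i) &
        A = \bigcap_(i in [set` s]) B i]].

Let GT i : G i setT.
Proof. by have [h0 hD _] := sG i; rewrite -(setD0 setT); exact: hD. Qed.

Let GI i A B : G i A -> G i B -> G i (A `&` B).
Proof.
rewrite -(measurable_g_measurableTypeE (sG i)) => GA GB; exact: measurableI.
Qed.

Lemma fin_inter_sub (D : set I) i : D i -> G i `<=` fin_inter D.
Proof.
move=> Di A GA; exists [:: i], (fun=> A); split => //.
- by move=> j; rewrite inE => /eqP ->.
- by move=> j; rewrite inE => /eqP ->.
- by apply/seteqP; split=> [x Ax j _ //|x]; apply; rewrite /= inE.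
Qed.

Lemma fin_interT (D : set I) : fin_inter D setT.
Proof.
exists [::], (fun=> setT); split => //.
by apply/seteqP; split.
Qed.

Lemma fin_interI (D : set I) : setI_closed (fin_inter D).
Proof.
move=> _ _ [s1 [B1 [u1 D1 G1 ->]]] [s2 [B2 [u2 D2 G2 ->]]].
(* An index occurring in both lists contributes both of its events; an index missing from one list
   contributes the neutral event [setT] there. *)
pose B i := (if i \in s1 then B1 i else setT) `&` (if i \in s2 then B2 i else setT).
exists (undup (s1 ++ s2)), B; split.
- exact: undup_uniq.
- by move=> i; rewrite mem_undup mem_cat => /orP[/D1|/D2].
- move=> i _; apply: GI; case: ifPn => // h; [exact: G1|exact: G2].
- apply/seteqP; split=> [x [h1 h2] i /= _|x h].
    by split; case: ifPn => // hi; [exact: h1|exact: h2].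
  split=> i /= his; have := h i; rewrite /= mem_undup mem_cat his ?orbT /B => /(_ isT) [];
  by rewrite his.
Qed.

Lemma fin_inter_measurable (D : set I) : fin_inter D `<=` measurable.
Proof.
move=> _ [s [B [_ _ GB ->]]]; apply: fin_bigcap_measurable => //.
by move=> i /= si; exact/Gm/GB.
Qed.

(** On the generating pi-systems, two finite intersections over disjoint index lists form one
    intersection over the concatenated list, whose probability factors. *)
Lemma mutually_independent_group (D D1 D2 : set I) :
  mutually_independent P D G -> D1 `<=` D -> D2 `<=` D ->
  (forall i, D1 i -> D2 i -> False) ->
  independent2 P <<s \bigcup_(i in D1) G i >> <<s \bigcup_(i in D2) G i >>.
Proof.
move=> indep D1D D2D D12.
apply: (@independent2_sub <<s fin_inter D1 >> <<s fin_inter D2 >>).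
- by apply: sub_sigma_algebra2 => A [i Di GA]; exact: (fin_inter_sub Di GA).
- by apply: sub_sigma_algebra2 => A [i Di GA]; exact: (fin_inter_sub Di GA).
apply: independent2_g_sigma; try exact: fin_inter_measurable;
  try exact: fin_interI; try exact: fin_interT.
move=> _ _ [s1 [B1 [u1 hD1 G1 ->]]] [s2 [B2 [u2 hD2 G2 ->]]].
pose B i := if i \in s1 then B1 i else B2 i.
have dis i : i \in s2 -> (i \in s1) = false.
  by move=> is2; apply/negP => is1; apply: (D12 i); [exact: hD1|exact: hD2].
have E1 : \bigcap_(i in [set` s1]) B1 i = \bigcap_(i in [set` s1]) B i.
  by apply: eq_bigcapr => i /= is1; rewrite /B is1.
have E2 : \bigcap_(i in [set` s2]) B2 i = \bigcap_(i in [set` s2]) B i.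
  by apply: eq_bigcapr => i /= is2; rewrite /B dis.
have u : uniq (s1 ++ s2).
  rewrite cat_uniq u1 u2 andbT /=; apply/hasPn => i is2; apply/negP => is1.
  by move: (dis _ is2); rewrite is1.
have GB i : i \in s1 ++ s2 -> G i (B i).
  rewrite mem_cat /B; case: ifPn => [is1 _|_ /= is2]; [exact: G1|exact: G2].
have GB1 i : i \in s1 -> G i (B i) by move=> is1; apply: GB; rewrite mem_cat is1.
have GB2 i : i \in s2 -> G i (B i) by move=> is2; apply: GB; rewrite mem_cat is2 orbT.
rewrite E1 E2.
have -> : \bigcap_(i in [set` s1]) B i `&` \bigcap_(i in [set` s2]) B i = \bigcap_(i in [set` s1 ++ s2]) B i.
  by rewrite !bigcap_seq big_cat.
rewrite !(indep _ _ _ B) // ?big_cat//=.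
- by move=> i /hD2/D2D.
- by move=> i /hD1/D1D.
- by move=> i; rewrite mem_cat => /orP[/hD1/D1D|/hD2/D2D].
Qed.

End grouping.
End independence_lemmas.

(** * Bounded measurable functions *)

Section bounded_measurable.
Context (R : realType).

(** This class is closed under all operations of the scheme, is integrable under every probability,
    and makes Fubini's theorem unconditional. *)
Definition bounded_measurable d (T : measurableType d) (f : T -> R) :=
  measurable_fun setT f /\ exists B, forall x, `|f x| <= B.

Context d (T : measurableType d) (P : probability T R).
Implicit Types (f g : T -> R).

Lemma bm_comp d' (T' : measurableType d') (h : T' -> T) f :
  measurable_fun setT h -> bounded_measurable f -> bounded_measurable (f \o h).
Proof.
move=> mh [mf [B fB]]; split; first exact: measurableT_comp.
by exists B => x; exact: fB.
Qed.

Lemma bm_cst (c : R) : bounded_measurable (fun _ : T => c).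
Proof. by split => //; exists `|c|. Qed.

Lemma bmD f g : bounded_measurable f -> bounded_measurable g ->
  bounded_measurable (fun x => f x + g x).
Proof.
move=> [mf [B fB]] [mg [B' gB]]; split; first exact: measurable_funD.
exists (B + B') => x; exact: le_trans (ler_normD _ _) (lerD (fB x) (gB x)).
Qed.

Lemma bmM f g : bounded_measurable f -> bounded_measurable g ->
  bounded_measurable (fun x => f x * g x).
Proof.
move=> [mf [B fB]] [mg [B' gB]]; split; first exact: measurable_funM.
by exists (B * B') => x; rewrite normrM ler_pM.
Qed.

Lemma bmZ (c : R) f : bounded_measurable f -> bounded_measurable (fun x => c * f x).
Proof. exact: bmM (bm_cst c). Qed.

Lemma bmN f : bounded_measurable f -> bounded_measurable (fun x => - f x).
Proof.
by move=> /(bmZ (-1)); under eq_fun do rewrite mulN1r.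
Qed.

Lemma bmB f g : bounded_measurable f -> bounded_measurable g ->
  bounded_measurable (fun x => f x - g x).
Proof. by move=> bf bg; exact: bmD bf (bmN bg). Qed.

Lemma bmX n f : bounded_measurable f -> bounded_measurable (fun x => f x ^+ n).
Proof.
move=> bf; elim: n => [|n ih]; first exact: (bm_cst 1).
by under eq_fun do rewrite exprS; exact: bmM.
Qed.

Lemma bm_sum (I : eqType) (s : seq I) (F : I -> T -> R) :
  (forall i, i \in s -> bounded_measurable (F i)) ->
  bounded_measurable (fun x => \sum_(i <- s) F i x).
Proof.
elim: s => [|i s ih] bF.
  by under eq_fun do rewrite big_nil; exact: bm_cst.
under eq_fun do rewrite big_cons; apply: bmD; first by apply: bF; rewrite mem_head.
by apply: ih => j js; apply: bF; rewrite inE js orbT.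
Qed.

Lemma bm_integrable f : bounded_measurable f -> P.-integrable setT (EFin \o f).
Proof.
move=> [mf [B fB]]; apply: measurable_bounded_integrable => //.
  by rewrite (le_lt_trans (probability_le1 P measurableT)) ?ltry.
exists B; split; first exact: num_real.
by move=> M BM x _ /=; exact: le_trans (fB x) (ltW BM).
Qed.

Lemma bm_EFin f : bounded_measurable f ->
  (\int[P]_x f x)%:E = (\int[P]_x (f x)%:E)%E.
Proof.
move=> /bm_integrable fi; rewrite /Rintegral fineK //; exact: integrable_fin_num.
Qed.

Lemma bm_intD f g : bounded_measurable f -> bounded_measurable g ->
  \int[P]_x (f x + g x) = \int[P]_x f x + \int[P]_x g x.
Proof. by move=> /bm_integrable bf /bm_integrable bg; rewrite RintegralD. Qed.

Lemma bm_intB f g : bounded_measurable f -> bounded_measurable g ->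
  \int[P]_x (f x - g x) = \int[P]_x f x - \int[P]_x g x.
Proof. by move=> /bm_integrable bf /bm_integrable bg; rewrite RintegralB. Qed.

Lemma bm_intZ (c : R) f : bounded_measurable f ->
  \int[P]_x (c * f x) = c * \int[P]_x f x.
Proof. by move=> /bm_integrable bf; rewrite RintegralZl. Qed.

Lemma bm_int_cst (c : R) : \int[P]_x c = c.
Proof.
rewrite Rintegral_cst // [X in fine X](_ : _ = 1%E) ?mulr1 //.
exact: probability_setT.
Qed.

Lemma bm_int_sum (I : eqType) (s : seq I) (F : I -> T -> R) :
  (forall i, i \in s -> bounded_measurable (F i)) ->
  \int[P]_x (\sum_(i <- s) F i x) = \sum_(i <- s) \int[P]_x F i x.
Proof.
elim: s => [|i s ih] bF.
  by under eq_Rintegral do rewrite big_nil; rewrite big_nil bm_int_cst.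
have bFs j : j \in s -> bounded_measurable (F j).
  by move=> js; apply: bF; rewrite inE js orbT.
under eq_Rintegral do rewrite big_cons.
rewrite bm_intD; [|by apply: bF; rewrite mem_head|exact: bm_sum].
by rewrite big_cons ih.
Qed.

Lemma bm_int_le f g : bounded_measurable f -> bounded_measurable g ->
  (forall x, f x <= g x) -> \int[P]_x f x <= \int[P]_x g x.
Proof. by move=> /bm_integrable bf /bm_integrable bg fg; exact: le_Rintegral. Qed.

Lemma bm_int_ge0 f : (forall x, 0 <= f x) -> 0 <= \int[P]_x f x.
Proof. by move=> f0; exact: Rintegral_ge0. Qed.

Lemma bm_int_norm f B : bounded_measurable f -> (forall x, `|f x| <= B) ->
  `|\int[P]_x f x| <= B.
Proof.
move=> bf fB; rewrite ler_norml -{1}(bm_int_cst (- B)) -{2}(bm_int_cst B).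
apply/andP; split; apply: bm_int_le => //; try exact: bm_cst.
- by move=> x; have := fB x; rewrite ler_norml => /andP[].
- by move=> x; have := fB x; rewrite ler_norml => /andP[].
Qed.

(** Bias-variance decomposition: with m the mean, the cross term 2 (m - c) (f - m) integrates to
    zero. *)
Lemma bm_variance f : bounded_measurable f -> forall c,
  \int[P]_x (f x - c) ^+ 2 =
  \int[P]_x (f x - \int[P]_y f y) ^+ 2 + (\int[P]_y f y - c) ^+ 2.
Proof.
move=> bf c; set m := \int[P]_y f y.
have bfm : bounded_measurable (fun x => f x - m) by apply: bmB => //; exact: bm_cst.
rewrite (_ : (fun x => _) = fun x => (f x - m) ^+ 2 +
   (2 * (m - c) * (f x - m) + (m - c) ^+ 2)); last by apply/funext => x; ring.
rewrite bm_intD; [|exact: bmX|by apply: bmD; [exact: bmZ|exact: bm_cst]].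
rewrite bm_intD; [|exact: bmZ|exact: bm_cst].
rewrite bm_intZ // bm_int_cst bm_intB //; last exact: bm_cst.
by rewrite bm_int_cst subrr mulr0 add0r.
Qed.

Lemma bm_sqr_int f : bounded_measurable f ->
  (\int[P]_x f x) ^+ 2 <= \int[P]_x f x ^+ 2.
Proof.
move=> bf; have := bm_variance bf 0; rewrite subr0.
under eq_Rintegral do rewrite subr0.
by move=> ->; rewrite lerDr bm_int_ge0 // => x; exact: sqr_ge0.
Qed.

Lemma bm_variance_le f : bounded_measurable f -> forall c,
  \int[P]_x (f x - \int[P]_y f y) ^+ 2 <= \int[P]_x (f x - c) ^+ 2.
Proof. by move=> bf c; rewrite [leRHS](bm_variance bf c) lerDl sqr_ge0. Qed.

End bounded_measurable.

Lemma Rintegral_distribution (R : realType) d d' (T : measurableType d)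
    (P : probability T R) (T' : measurableType d') (X : T -> T')
    (mX : measurable_fun setT X) (f : T' -> R) : bounded_measurable f ->
  \int[distribution P (mfun_Sub (mem_set mX))]_y f y = \int[P]_x f (X x).
Proof.
move=> bf; rewrite /Rintegral; congr fine.
rewrite [LHS](integral_pushforward mX) //.
- by apply/measurable_EFinP; case: bf.
- exact: (bm_integrable P (bm_comp mX bf)).
Qed.

(** * Fubini's theorem and the freezing of independent variables *)

Section fubini_bounded.
Context (R : realType) d1 d2 (T1 : measurableType d1) (T2 : measurableType d2).
Variable P2 : probability T2 R.
Variable F : T1 * T2 -> R.
Hypothesis bF : bounded_measurable F.

Lemma bm_section1 x : bounded_measurable (fun y => F (x, y)).
Proof. by apply: (bm_comp (h := pair x)) bF. Qed.

Let intF (P1 : probability T1 R) : (P1 \x P2)%E.-integrable setT (EFin \o F).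
Proof.
case: bF => mF [B FB]; apply: measurable_bounded_integrable => //.
  have h : (P1 \x P2)%E setT = 1%E.
    transitivity (P1 setT * P2 setT)%E; last by rewrite !probability_setT mul1e.
    by rewrite -setXTT; exact: product_measure1E.
  by rewrite -[ltLHS]/((P1 \x P2)%E setT) h ltry.
exists B; split; first exact: num_real.
by move=> M BM x _ /=; exact: le_trans (FB x) (ltW BM).
Qed.

Lemma bm_fubini_F : bounded_measurable (fun x => \int[P2]_y F (x, y)).
Proof.
split.
  (* Fubini's theorem speaks of a measure on [T1] as well; the inner integral does not depend on it,
     so a Dirac mass serves. *)
  have := measurable_fubini_F (intF (dirac point)); rewrite /fubini_F => h.
  apply/measurable_EFinP; apply: eq_measurable_fun h => x _ /=.
  by rewrite -bm_EFin //; exact: bm_section1.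
have [_ [B FB]] := bF; exists B => x.
by apply: bm_int_norm => //; exact: bm_section1.
Qed.

Lemma bm_fubini (P1 : probability T1 R) :
  \int[(P1 \x P2)%E]_z F z = \int[P1]_x \int[P2]_y F (x, y).
Proof.
rewrite /Rintegral; congr fine.
rewrite -(integral12_prod_meas1 (intF P1)) /fubini_F.
apply: eq_integral => x _ /=; rewrite bm_EFin //; exact: bm_section1.
Qed.

End fubini_bounded.

(** Sub-sigma-algebras are separate measurable types on the same points; composing with this
    identity turns measurability for the coarse type into plain measurability. *)
Lemma g_sigma_id_measurable (d : measure_display) (T : measurableType d)
    (G : set_system T) : G `<=` measurable ->
  measurable_fun setT (id : T -> g_sigma_algebraType G).
Proof.
move=> Gm _ A GA; rewrite setTI preimage_id.
by apply: (smallest_sub _ Gm) GA; exact: sigma_algebra_measurable.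
Qed.

Section freezing.
Context (R : realType) d (T : measurableType d) (P : probability T R).
Variables (G H : set_system T).
Hypotheses (Gm : G `<=` measurable) (Hm : H `<=` measurable).
Hypothesis GH : independent2 P <<s G >> <<s H >>.
Local Notation TG := (g_sigma_algebraType G).
Local Notation TH := (g_sigma_algebraType H).

(* By independence the law of [w |-> (w, w)] on the product of [T] with the two
   sigma-algebras is the product measure. *)
Theorem freezing (F : TG * TH -> R) : bounded_measurable F ->
  \int[P]_w F (w, w) = \int[P]_w1 \int[P]_w2 F (w1, w2).
Proof.
move=> bF.
have mG := g_sigma_id_measurable Gm; have mH := g_sigma_id_measurable Hm.
pose PG : probability TG R := distribution P (mfun_Sub (mem_set mG)).
pose PH : probability TH R := distribution P (mfun_Sub (mem_set mH)).
have mD : measurable_fun setT (fun w : T => ((w, w) : TG * TH)).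
  by apply: (measurable_fun_pair mG mH).
pose PD : probability (TG * TH)%type R := distribution P (mfun_Sub (mem_set mD)).
rewrite -(Rintegral_distribution P mD bF) -/PD.
transitivity (\int[(PG \x PH)%E]_z F z).
  rewrite /Rintegral; congr fine; apply: eq_measure_integral => //= A mA _.
  (* On a rectangle the law of the diagonal map is the probability of the intersection of the two
     sides, so independence is exactly the premise of uniqueness. *)
  apply/esym; apply: product_measure_unique => // B C mB mC.
rewrite bm_fubini // (Rintegral_distribution P mG); last exact: bm_fubini_F.
apply: eq_Rintegral => w _.
by rewrite (Rintegral_distribution P mH) //; exact: bm_section1.
Qed.

End freezing.

Lemma g_sigma_measurable_fun d (T : measurableType d) (U : pointedType)
    (G : set_system U) (X : T -> U) :
  (forall A, G A -> measurable (X @^-1` A)) ->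
  measurable_fun setT (X : T -> g_sigma_algebraType G).
Proof.
move=> XG; apply: (@measurability _ _ T (g_sigma_algebraType G) setT X G erefl) => _ [A GA <-].
by rewrite setTI; exact: XG.
Qed.

(** * Random vectors and laws *)

Section row_vectors.
Variables (R : realType) (n : nat).

(** Generators of the product sigma-algebra on R^n, in accordance with the coordinatewise encoding
    of [sigma_rvec]. *)
Definition rV_coordinate_sets : set_system 'rV[R]_n :=
  \bigcup_(i in [set: 'I_n]) preimage_set_system setT
    (fun x : 'rV[R]_n => x 0 i) measurable.

Definition rVm := g_sigma_algebraType rV_coordinate_sets.

Lemma rVm_coord (i : 'I_n) : measurable_fun setT (fun x : rVm => x 0 i).
Proof.
move=> _ B mB; rewrite setTI; apply: sub_sigma_algebra; exists i => //.
by exists B => //; rewrite setTI.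
Qed.

Lemma measurable_rVm d (T : measurableType d) (X : T -> 'rV[R]_n) :
  (forall i, measurable_fun setT (fun w => X w 0 i)) ->
  measurable_fun setT (X : T -> rVm).
Proof.
move=> mX; apply: g_sigma_measurable_fun => _ [i _ [B mB <-]].
by rewrite setTI -[X in measurable X]setTI; exact: mX.
Qed.

Lemma measurable_rVmD d (T : measurableType d) (X Y : T -> rVm) :
  measurable_fun setT X -> measurable_fun setT Y ->
  measurable_fun setT ((fun w => (X w : 'rV[R]_n) + (Y w : 'rV[R]_n)) : T -> rVm).
Proof.
move=> mX mY; apply: measurable_rVm => i; under eq_fun do rewrite mxE.
by apply: measurable_funD; [exact: (measurableT_comp (rVm_coord i) mX)|
  exact: (measurableT_comp (rVm_coord i) mY)].
Qed.

Lemma measurable_rVmB d (T : measurableType d) (X Y : T -> rVm) :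
  measurable_fun setT X -> measurable_fun setT Y ->
  measurable_fun setT ((fun w => (X w : 'rV[R]_n) - (Y w : 'rV[R]_n)) : T -> rVm).
Proof.
move=> mX mY; apply: measurable_rVm => i; under eq_fun do rewrite !mxE.
by apply: measurable_funB; [exact: (measurableT_comp (rVm_coord i) mX)|
  exact: (measurableT_comp (rVm_coord i) mY)].
Qed.

(** An open set is the union of the boxes with rational centre and half-width 1 / (m + 1) that it
    contains; these boxes are countably many, and each is a finite intersection of coordinate
    sets. *)
Lemma continuous_rVm_measurable (f : 'rV[R]_n -> R) :
  continuous f -> measurable_fun setT (f : rVm -> R).
Proof.
move=> cf; apply: (@measurability _ _ rVm _ setT f _ (RGenOpens.measurableE R)) => _ [_ [a [b ->]] <-].
rewrite setTI.
set A := f @^-1` _.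
have oA : open A by apply: open_comp => // x _; exact: cf.
pose box (q : 'rV[rat]_n * nat) : set 'rV[R]_n :=
  [set x | forall i, `|x 0 i - ratr (q.1 0 i)| < q.2.+1%:R^-1].
have mbox q : measurable (box q : set rVm).
  rewrite (_ : box q = \bigcap_(i in [set: 'I_n])
     ((fun x : rVm => x 0 i) @^-1` [set y : R | `|y - ratr (q.1 0 i)| < q.2.+1%:R^-1])).
    apply: fin_bigcap_measurable => // i _.
    rewrite -[X in measurable X]setTI; apply: rVm_coord => //.
    rewrite (_ : [set y | _] = `]ratr (q.1 0 i) - q.2.+1%:R^-1, ratr (q.1 0 i) + q.2.+1%:R^-1[%classic).
      exact: measurable_itv.
    apply/seteqP; split=> y /=; rewrite in_itv /= ltr_distl //.
  apply/seteqP; split=> [x bx i _|x bx i]; first exact: bx.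
  exact: bx.
rewrite (_ : A = \bigcup_q (if pselect (box q `<=` A) then box q else set0)).
  apply: countable_bigcupT_measurable => // q; case: pselect => bA; [exact: mbox|exact: measurable0].
apply/seteqP; split=> [x Ax|x [q _]]; last by case: pselect => // h; exact: h.
have /nbhs_ballP[e /= e0 eA] : nbhs x A by exact: open_nbhs_nbhs.
(* The centre is within 1 / (m + 1) of [x], so every point of the box is within twice that distance
   of [x]; hence e / 2. *)
have [m me] : exists m : nat, m.+1%:R^-1 < e / 2.
  have e2 : 0 < e / 2 by rewrite divr_gt0.
  have [m _ hm] := near_infty_natSinv_lt (PosNum e2).
  by exists m; apply: (hm m) => /=.
have hq i : exists q : rat, `|x 0 i - ratr q| < m.+1%:R^-1.
  have m0 : 0 < m.+1%:R^-1 :> R by rewrite invr_gt0.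
  have [q] := rat_in_itvoo (ltr_pwDr m0 (lexx (x 0 i))).
  rewrite in_itv /= => /andP[h1 h2]; exists q.
  by rewrite ltr_distlC h2 andbT (lt_trans _ h1) // ltrBlDr ltrDl.
have [q hq'] := choice hq.
pose Q : 'rV[rat]_n := \row_i q i.
exists (Q, m) => //; case: pselect => [_ i|]; first by rewrite mxE; exact: hq'.
case=> y yb; apply: eA; split=> // i j; rewrite /ball /= ord1.
have := yb j; have := hq' j; rewrite /= mxE => h1 h2.
rewrite -(subrK (ratr (q j)) (x 0 j)) -addrA (le_lt_trans (ler_normD _ _)) //.
by rewrite [e](splitr e) ltrD // ?(lt_trans h1) // distrC (lt_trans h2).
Qed.

End row_vectors.

(** Boxes form a pi-system generating the product sigma-algebra, and the probability of a box is a
    product of one-dimensional normal probabilities, the same for both vectors. *)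
Lemma isotropic_normal_law (R : realType) (disp : measure_display)
    (Omega : measurableType disp) (P : probability Omega R) (n : nat) (sigma : R)
    (X X' : Omega -> 'rV[R]_n) :
  measurable_fun setT (X : Omega -> rVm R n) ->
  measurable_fun setT (X' : Omega -> rVm R n) ->
  is_isotropic_normal P sigma X -> is_isotropic_normal P sigma X' ->
  forall psi : rVm R n -> R, bounded_measurable psi ->
  \int[P]_w psi (X w) = \int[P]_w psi (X' w).
Proof.
move=> mX mX' nX nX' psi bpsi.
pose Pi : set_system (rVm R n) := [set A | exists B : 'I_n -> set R,
  (forall i, measurable (B i)) /\ A = [set x | forall i, B i ((x : 'rV[R]_n) 0 i)]].
have law (Y : Omega -> 'rV[R]_n) : is_isotropic_normal P sigma Y ->
    forall B : 'I_n -> set R, (forall i, measurable (B i)) ->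
    P [set w | forall i, B i (Y w 0 i)] =
      (\prod_(i <- enum 'I_n) normal_prob 0 sigma (B i))%E.
  move=> [indepY nY] B mB.
  rewrite (eq_bigr (fun i => P [set w | B i (Y w 0 i)])) => [|i _]; last by rewrite nY.
  rewrite -(indepY (enum 'I_n) (enum_uniq _) _ (fun i => [set w | B i (Y w 0 i)])) //.
    congr (P _); apply/seteqP; split=> [w Bw i _|w Bw i]; first exact: Bw.
    by apply: Bw; rewrite /= mem_enum.
  move=> i _; apply: sub_sigma_algebra; exists tt => //.
  by exists (B i) => //; rewrite setTI.
rewrite -(Rintegral_distribution P mX bpsi) -(Rintegral_distribution P mX' bpsi).
rewrite /Rintegral; congr fine; apply: eq_measure_integral => A mA _.
apply: (measure_unique Pi (fun=> setT)) => //.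
- apply/seteqP; split; apply: smallest_sub; try exact: smallest_sigma_algebra.
    move=> _ [i _ [B mB <-]]; apply: sub_sigma_algebra.
    exists (fun j => if j == i then B else setT); split.
      by move=> j; case: ifP.
    apply/seteqP; split=> [x [_ Bx] j|x /(_ i)]; first by case: eqP => // ->.
    by rewrite eqxx.
  move=> _ [B [mB ->]].
  rewrite (_ : [set x | _] = \bigcap_(i in [set: 'I_n])
      ((fun x : rVm R n => x 0 i) @^-1` (B i))); last first.
    by apply/seteqP; split=> [x h i _|x h i]; exact: h.
  apply: fin_bigcap_measurable => // i _.
  by rewrite -[X in measurable X]setTI; exact: rVm_coord.
- move=> _ _ [B [mB ->]] [C [mC ->]]; exists (fun i => B i `&` C i); split.
    by move=> i; exact: measurableI.
  apply/seteqP; split=> [x [h1 h2] i|x h]; first by split.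
  by split=> i; have [] := h i.
- by move=> _; exists (fun=> setT); split => //; apply/seteqP; split.
- by apply/seteqP; split=> // x _; exists 0%N.
- move=> _ [B [mB ->]]; transitivity (P [set w | forall i, B i (X w 0 i)]) => //.
  by rewrite law // -(law X').
- by move=> _; rewrite -[ltLHS]/(P setT) probability_setT ltry.
Qed.

(** * Equality in law and independence of real variables *)

Section independent_functions.
Context (R : realType) d (T : measurableType d) (P : probability T R).

Definition eqlaw (X Y : T -> R) := forall phi : R -> R, bounded_measurable phi ->
  \int[P]_w phi (X w) = \int[P]_w phi (Y w).

Lemma eqlaw_comp (g : R -> R) X Y : measurable_fun setT g -> eqlaw X Y ->
  eqlaw (g \o X) (g \o Y).
Proof. by move=> mg XY phi bphi; exact: (XY (phi \o g) (bm_comp mg bphi)). Qed.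

(** The witnesses are generating families rather than sigma-algebras, since this is the form to
    which [freezing] applies. *)
Definition indep_rv (X Y : T -> R) := exists G H : set_system T,
  [/\ G `<=` measurable, H `<=` measurable, independent2 P <<s G >> <<s H >>,
   measurable_fun setT (X : g_sigma_algebraType G -> R) &
   measurable_fun setT (Y : g_sigma_algebraType H -> R)].

Lemma indep_rv_int X Y (F : R * R -> R) : indep_rv X Y ->
  bounded_measurable F ->
  \int[P]_w F (X w, Y w) = \int[P]_w1 \int[P]_w2 F (X w1, Y w2).
Proof.
move=> [G [H [Gm Hm GH mX mY]]] bF.
apply: (freezing Gm Hm GH (F := fun z => F (X z.1, Y z.2))).
apply: (bm_comp _ bF); apply: measurable_fun_pair.
  exact: (measurableT_comp mX).
exact: (measurableT_comp mY).
Qed.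

Lemma sub_g_sigma_measurable d' (T' : measurableType d') (G : set_system T) (X : T -> T') :
  G `<=` measurable -> measurable_fun setT (X : g_sigma_algebraType G -> T') ->
  measurable_fun setT X.
Proof.
by move=> Gm mX; exact: (measurableT_comp mX (g_sigma_id_measurable Gm)).
Qed.

Lemma indep_rvM X Y : indep_rv X Y -> bounded_measurable X -> bounded_measurable Y ->
  \int[P]_w (X w * Y w) = (\int[P]_w X w) * (\int[P]_w Y w).
Proof.
move=> [G [H [Gm Hm GH mX mY]]] bX bY.
rewrite (freezing Gm Hm GH (F := fun z => X z.1 * Y z.2)) /=.
  rewrite mulrC -bm_intZ; last exact: bX.
  by apply: eq_Rintegral => w _; rewrite bm_intZ // mulrC.
case: bX bY => _ [B XB] [_ [B' YB]]; split; last first.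
  by exists (B * B') => z; rewrite normrM ler_pM.
apply: measurable_funM; first exact: (measurableT_comp mX).
exact: (measurableT_comp mY).
Qed.

(** By independence the integral of phi(X + Y) is an iterated one. The law of [Y] is exchanged
    inside; the inner integral is then a bounded measurable function of the value of [X], whose law
    is exchanged next. *)
Lemma eqlawD X Y X' Y' : indep_rv X Y -> indep_rv X' Y' -> eqlaw X X' ->
  eqlaw Y Y' -> eqlaw (fun w => X w + Y w) (fun w => X' w + Y' w).
Proof.
move=> iXY iXY' XX YY phi bphi.
have bF : bounded_measurable (fun z : R * R => phi (z.1 + z.2)).
  by apply: (bm_comp (h := fun z : R * R => z.1 + z.2)) => //; exact: measurable_funD.
rewrite (indep_rv_int iXY bF) (indep_rv_int iXY' bF) /=.
transitivity (\int[P]_w1 \int[P]_w2 phi (X w1 + Y' w2)).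
  apply: eq_Rintegral => w _; apply: (YY (fun a => phi (X w + a))).
  by apply: (bm_comp (h := fun a => X w + a)) bphi; exact: measurable_funD.
apply: (XX (fun a => \int[P]_w2 phi (a + Y' w2))).
have [G [H [Gm Hm GH mX mY]]] := iXY'.
have mY' := sub_g_sigma_measurable Hm mY.
have b2 : bounded_measurable (fun z : R * T => phi (z.1 + Y' z.2)).
  apply: (bm_comp (h := fun z : R * T => z.1 + Y' z.2)) bphi.
  by apply: measurable_funD => //; exact: (measurableT_comp mY').
exact: (bm_fubini_F P b2).
Qed.

End independent_functions.

Section sum_family.
Context (disp : measure_display) (Omega : measurableType disp) (R : realType).
Variable P : probability Omega R.
Variables (I J : choiceType) (G : I -> set_system Omega) (H : J -> set_system Omega).

Definition sum_family (i : I + J) : set_system Omega :=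
  match i with inl i => G i | inr j => H j end.

(** A finite index list is split into its left and right members: independence of [GG] and [HH]
    separates the two intersections, and each then factors within its own family. *)
Lemma mutually_independent_sum (GG HH : set_system Omega) :
  mutually_independent P [set: I] G -> mutually_independent P [set: J] H ->
  sigma_algebra setT GG -> sigma_algebra setT HH ->
  (forall i, G i `<=` GG) -> (forall j, H j `<=` HH) ->
  independent2 P GG HH ->
  mutually_independent P [set: I + J] sum_family.
Proof.
move=> iG iH sGG sHH GGG HHH iGH s us _ A GA.
pose fl (x : I + J) : option I := if x is inl i then Some i else None.
pose fr (x : I + J) : option J := if x is inr j then Some j else None.
pose sl := pmap fl s; pose sr := pmap fr s.
have ml i : (i \in sl) = (inl i \in s).
  rewrite mem_pmap; apply/mapP/idP => [[[x|x] xs //= [->]]//|h].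
  by exists (inl i).
have mr j : (j \in sr) = (inr j \in s).
  rewrite mem_pmap; apply/mapP/idP => [[[x|x] xs //= [->]]//|h].
  by exists (inr j).
have ul : uniq sl.
  by apply: (@pmap_uniq _ _ _ inl) => // -[x|x] //=.
have ur : uniq sr.
  by apply: (@pmap_uniq _ _ _ inr) => // -[x|x] //=.
have -> : \bigcap_(i in [set` s]) A i =
   (\bigcap_(i in [set` sl]) A (inl i)) `&` (\bigcap_(j in [set` sr]) A (inr j)).
  apply/seteqP; split=> [w Aw|w [Al Ar] [i|j] /= ijs].
  - by split=> i; rewrite /= ?ml ?mr => h; exact: Aw.
  - by apply: Al; rewrite /= ml.
  - by apply: Ar; rewrite /= mr.
have capS (K : choiceType) (F : set_system Omega) (t : seq K) (B : K -> set Omega) :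
    sigma_algebra setT F -> (forall i, i \in t -> F (B i)) ->
    F (\bigcap_(i in [set` t]) B i).
  move=> sF FB; rewrite -(measurable_g_measurableTypeE sF).
  apply: fin_bigcap_measurable => // i /= it.
  by rewrite (measurable_g_measurableTypeE sF); exact: FB.
rewrite iGH; first last.
- by apply: capS => // j; rewrite mr => js; apply: HHH; exact: (GA (inr j)).
- by apply: capS => // i; rewrite ml => js; apply: GGG; exact: (GA (inl i)).
rewrite (iG sl) ?(iH sr) //; first last.
- by move=> i; rewrite ml => /GA.
- by move=> i; rewrite mr => /GA.
rewrite /sl /sr; elim: s {us GA sl sr ml mr ul ur} => [|[i|j] s ih] /=.
- by rewrite !big_nil mule1.
- by rewrite !big_cons -ih muleA.
- by rewrite !big_cons -ih muleCA.
Qed.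

End sum_family.

Lemma g_sigma_sub_measurable_id (U : pointedType) (G H : set_system U) :
  G `<=` <<s H >> ->
  measurable_fun setT (id : g_sigma_algebraType H -> g_sigma_algebraType G).
Proof. by move=> GH; apply: g_sigma_measurable_fun => A /GH. Qed.

(** * The sources of randomness *)

Section randomness.
Context (R : realType) (T : R) (T_gt0 : 0 < T).
Context (disp : measure_display) (Omega : measurableType disp)
  (P : probability Omega R).
Context (r : Theta -> Omega -> R)
  (r_meas : forall theta, measurable_fun [set: Omega] (r theta))
  (r_range : forall theta w, 0 < r theta w < 1)
  (r_indep : mutually_independent P [set: Theta]
     (fun theta => sigma_rv [set: unit] (fun _ => r theta)))
  (r_ident : forall (theta theta' : Theta) (B : set R), measurable B ->
     P [set w | B (r theta w)] = P [set w | B (r theta' w)])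
  (r_unif : forall t : R, 0 < t < 1 -> P [set w | r theta0 w <= t] = t%:E).
Context (d : nat) (W : Theta -> R -> Omega -> 'rV[R]_d)
  (W_brownian : forall theta, is_brownian_motion P T (W theta))
  (W_indep : mutually_independent P [set: Theta]
     (fun theta => sigma_process T (W theta)))
  (r_W_indep : independent2 P (sigma_rv [set: Theta] r)
     <<s \bigcup_theta sigma_process T (W theta) >>).

Lemma sigma_rv_measurable (I : Type) (D : set I) (X : I -> Omega -> R) :
  (forall i, D i -> measurable_fun setT (X i)) -> sigma_rv D X `<=` measurable.
Proof.
move=> mX; apply: smallest_sub; first exact: sigma_algebra_measurable.
by move=> _ [i Di [B mB <-]]; exact: mX.
Qed.

Lemma sigma_process_measurable theta : sigma_process T (W theta) `<=` measurable.
Proof.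
apply: sigma_rv_measurable => -[t i] /= tT.
exact: (brownian_measurable (W_brownian theta) i tT).
Qed.

Lemma sigma_rv_sub (I J : Type) (D : set I) (E : set J) (X : I -> Omega -> R)
    (Y : J -> Omega -> R) :
  (forall i, D i -> exists2 j, E j & X i = Y j) -> sigma_rv D X `<=` sigma_rv E Y.
Proof.
move=> XY; apply: sub_sigma_algebra2 => A [i /XY[j Ej ->] XA]; by exists j.
Qed.

(** The uniform variable and the Brownian motion of an index are separate members of one mutually
    independent family, so that the grouping lemma covers both kinds at once. *)
Definition source : Theta + Theta -> set_system Omega :=
  sum_family (fun theta => sigma_rv [set: unit] (fun _ => r theta))
    (fun theta => sigma_process T (W theta)).

Definition sources (D : set Theta) : set_system Omega :=
  \bigcup_(i in [set i : Theta + Theta | D (match i with inl t => t | inr t => t end)])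
     source i.

Lemma source_sub i : source i `<=` measurable.
Proof.
by case: i => t; [exact: sigma_rv_measurable|exact: sigma_process_measurable].
Qed.

Lemma sources_sub D : sources D `<=` measurable.
Proof. by move=> A [i _]; exact: source_sub. Qed.

Lemma sources_independent (D E : set Theta) :
  (forall theta, D theta -> E theta -> False) ->
  independent2 P <<s sources D >> <<s sources E >>.
Proof.
move=> DE; apply: (@mutually_independent_group _ _ _ _ _ source _ _ setT) => //.
- by case=> t; exact: smallest_sigma_algebra.
- exact: source_sub.
- apply: (mutually_independent_sum r_indep W_indep _ _ _ _ r_W_indep).
  + exact: smallest_sigma_algebra.
  + exact: smallest_sigma_algebra.
  + by move=> t; apply: sigma_rv_sub => _ _; exists t.
  + by move=> t A tA; apply: sub_sigma_algebra; exists t.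
- by move=> i; exact: DE.
Qed.

Lemma r_source (D : set Theta) theta : D theta ->
  measurable_fun setT (r theta : g_sigma_algebraType (sources D) -> R).
Proof.
move=> Dt _ B mB; rewrite setTI; apply: sub_sigma_algebra; exists (inl theta) => //.
by apply: sub_sigma_algebra; exists tt => //; exists B => //; rewrite setTI.
Qed.

Lemma W_source (D : set Theta) theta t : D theta -> 0 <= t <= T ->
  measurable_fun setT (W theta t : g_sigma_algebraType (sources D) -> rVm R d).
Proof.
move=> Dt tT; apply: measurable_rVm => i _ B mB.
rewrite setTI; apply: sub_sigma_algebra; exists (inr theta) => //.
apply: sub_sigma_algebra; exists (t, i) => //; exists B => //; rewrite setTI //.
Qed.

Lemma sources_mono (D E : set Theta) : D `<=` E ->
  measurable_fun setT (id : g_sigma_algebraType (sources E) ->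
                            g_sigma_algebraType (sources D)).
Proof.
move=> DE; apply: g_sigma_sub_measurable_id => A [i Di iA].
by apply: sub_sigma_algebra; exists i => //; exact: DE.
Qed.

Lemma W_measurable theta t : 0 <= t <= T ->
  measurable_fun setT (W theta t : Omega -> rVm R d).
Proof.
by move=> tT; apply: measurable_rVm => i;
  exact: (brownian_measurable (W_brownian theta) i tT).
Qed.

(** P(r < t) lies between P(r <= s) = s for all s < t and P(r <= t) = t; the endpoints 0 and 1
    follow from the range of [r]. The strict form is wanted because the cells of the time level are
    the half-open intervals [i / k, (i + 1) / k). *)
Lemma r_lt (theta : Theta) (t : R) : 0 <= t <= 1 ->
  P [set w | r theta w < t] = t%:E.
Proof.
move=> /andP[t0 t1].
have mr u : measurable [set w | r theta w < u].
  rewrite -[X in measurable X]setTI.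
  exact: (r_meas theta measurableT (measurable_itv `]-oo, u[)).
have mr' u : measurable [set w | r theta w <= u].
  rewrite -[X in measurable X]setTI.
  exact: (r_meas theta measurableT (measurable_itv `]-oo, u])).
have unif u : 0 < u < 1 -> P [set w | r theta w <= u] = u%:E.
  move=> u01; rewrite -r_unif //.
  exact: (r_ident theta theta0 (measurable_itv `]-oo, u])).
have lo s : 0 < s < t -> (s%:E <= P [set w | (r theta w < t)%R])%E.
  move=> /andP[s0 st]; rewrite -unif ?s0 ?(lt_le_trans st) //.
  by apply: le_measure; rewrite ?inE // => w /= h; exact: le_lt_trans h st.
apply/eqP; rewrite eq_le; apply/andP; split.
  have [t1'|t1'] := eqVneq t 1; first by rewrite t1' probability_le1.
  have [->|tn0] := eqVneq t 0.
    rewrite (_ : [set w | _] = set0) ?measure0 //.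
    by apply/seteqP; split=> // w /=; case/andP: (r_range theta w) => /ltW; rewrite leNgt => /negP.
  rewrite -unif ?lt_neqAle ?t1' ?t1 ?t0 ?andbT 1?eq_sym //.
  by apply: le_measure; rewrite ?inE // => w /= /ltW.
apply/lee_addgt0Pr => e e0.
have [te|et] := leP t e.
  by rewrite (le_trans (y := e%:E)) ?lee_fin // leeDr.
rewrite -leeBlDr //= -EFinB; apply: lo.
by rewrite subr_gt0 et ltrBlDr ltrDl.
Qed.

Lemma r_cell (theta : Theta) (k i : nat) : (i < k)%N ->
  measurable [set w | Num.truncn (k%:R * r theta w) = i] /\
  P [set w | Num.truncn (k%:R * r theta w) = i] = (k%:R^-1)%:E.
Proof.
move=> ik.
have k0 : 0 < k%:R :> R by rewrite ltr0n (leq_ltn_trans _ ik).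
have E : [set w | Num.truncn (k%:R * r theta w) = i] =
   [set w | r theta w < i.+1%:R / k%:R] `\` [set w | r theta w < i%:R / k%:R].
  apply/seteqP; split=> w /=.
    move=> <-; have /andP[r0 _] := r_range theta w.
    have /truncn_itv/andP[h1 h2] : 0 <= k%:R * r theta w by rewrite mulr_ge0 ?ltW.
    rewrite ltr_pdivlMr // [ltLHS]mulrC h2; split => //.
    by apply/negP; rewrite -leNgt ler_pdivrMr // [leRHS]mulrC.
  rewrite ltr_pdivlMr // => -[h1 /negP]; rewrite -leNgt ler_pdivrMr // => h2.
  by apply: truncn_def; rewrite mulrC h1 h2.
have mr u : measurable [set w | r theta w < u].
  rewrite -[X in measurable X]setTI.
  exact: (r_meas theta measurableT (measurable_itv `]-oo, u[)).
rewrite E; split; first exact: measurableD.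
have sub : [set w | r theta w < i%:R / k%:R] `<=` [set w | r theta w < i.+1%:R / k%:R].
  by move=> w /= h; apply: (lt_le_trans h); rewrite ler_pM2r ?invr_gt0 // ler_nat.
transitivity (P [set w | (r theta w < i.+1%:R / k%:R)%R]
    - P [set w | (r theta w < i%:R / k%:R)%R])%E.
  rewrite measureD // ?setIidr //.
  by rewrite (le_lt_trans (probability_le1 P (mr _))) ?ltry.
rewrite !r_lt; first last.
- by rewrite divr_ge0 //= ler_pdivrMr // mul1r ler_nat.
- by rewrite divr_ge0 //= ler_pdivrMr // mul1r ler_nat ltnW.
by rewrite -EFinB -mulrBl -natrB // subSnn mul1r.
Qed.

Context (K : nat) (K_gt0 : (0 < K)%N).

Definition grid (k : nat) : R := k%:R * T / K%:R.

Lemma grid0 : grid 0 = 0.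
Proof. by rewrite /grid !mul0r. Qed.

Lemma grid_le i k : (i <= k)%N -> grid i <= grid k.
Proof.
by move=> ik; rewrite ler_pM2r ?invr_gt0 ?ltr0n // ler_pM2r // ler_nat.
Qed.

Lemma grid_lt i k : (i < k)%N -> grid i < grid k.
Proof.
by move=> ik; rewrite ltr_pM2r ?invr_gt0 ?ltr0n // ltr_pM2r // ltr_nat.
Qed.

Lemma grid_itv k : (k <= K)%N -> 0 <= grid k <= T.
Proof.
move=> kK; rewrite -{1}grid0 grid_le //=.
by rewrite /grid ler_pdivrMr ?ltr0n // mulrC ler_pM2l // ler_nat.
Qed.

Lemma grid_sub i k : (i <= k)%N -> grid (k - i) = grid k - grid i.
Proof. by move=> ik; rewrite /grid natrB // !mulrBl. Qed.

Definition increment theta i k (w : Omega) : 'rV[R]_d :=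
  W theta (grid k) w - W theta (grid i) w.

Lemma increment_source (D : set Theta) theta i k : D theta ->
  (i <= K)%N -> (k <= K)%N ->
  measurable_fun setT (increment theta i k : g_sigma_algebraType (sources D) -> rVm R d).
Proof.
by move=> Dt iK kK; apply: measurable_rVmB; apply: W_source => //; exact: grid_itv.
Qed.

Lemma increment_measurable theta i k : (i <= K)%N -> (k <= K)%N ->
  measurable_fun setT (increment theta i k : Omega -> rVm R d).
Proof.
by move=> iK kK; apply: measurable_rVmB; apply: W_measurable; exact: grid_itv.
Qed.

(* The Brownian transition operator over [i] time steps; it is defined through an
   increment because W starts at 0 only almost surely. *)
Definition heat (i : nat) (psi : 'rV[R]_d -> R) (x : 'rV[R]_d) : R :=
  \int[P]_w psi (x + increment theta0 0 i w).

Lemma bm_shift d' (U : measurableType d') (X : U -> rVm R d) (psi : rVm R d -> R)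
    (x : 'rV[R]_d) : measurable_fun setT X -> bounded_measurable psi ->
  bounded_measurable (fun u => psi (x + (X u : 'rV[R]_d))).
Proof.
move=> mX bpsi; apply: (bm_comp (h := fun u => x + X u : rVm R d)) bpsi.
exact: measurable_rVmD.
Qed.

Lemma increment_law theta i k (psi : rVm R d -> R) (x : 'rV[R]_d) :
  (i <= k)%N -> (k <= K)%N -> bounded_measurable psi ->
  \int[P]_w psi (x + increment theta i k w) = heat (k - i) psi x.
Proof.
move=> ik kK bpsi; rewrite /heat.
(* Equal times are treated apart: normality of increments is only given for s < t, and here both
   increments vanish. *)
move: ik; rewrite leq_eqVlt => /predU1P[->|ik].
  rewrite subnn; apply: eq_Rintegral => w _; congr (psi (_ + _)).
  by rewrite /increment !subrr.
have b2 : bounded_measurable (fun y : rVm R d => psi (x + y)) by exact: bm_shift.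
have iK : (i <= K)%N by rewrite ltnW // (leq_trans ik).
have kiK : (k - i <= K)%N by rewrite (leq_trans (leq_subr _ _)).
have /andP[ti0 _] := grid_itv iK; have /andP[_ tkT] := grid_itv kK.
have /andP[_ tkiT] := grid_itv kiK.
apply: (@isotropic_normal_law _ _ _ _ _ (Num.sqrt (grid k - grid i)) _ _ _ _ _ _
  (fun y => psi (x + y))) => //.
- exact: increment_measurable.
- exact: increment_measurable.
- by apply: (brownian_normal_increments (W_brownian theta)) => //; exact: grid_lt.
- rewrite -grid_sub ?(ltnW ik) // -[grid (k - i)]subr0 -{1}grid0.
  apply: (brownian_normal_increments (W_brownian theta0)) => //; rewrite ?grid0 //.
  by rewrite -grid0 grid_lt // subn_gt0.
Qed.

Lemma W_grid_law theta k (psi : rVm R d -> R) (x : 'rV[R]_d) :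
  (k <= K)%N -> bounded_measurable psi ->
  \int[P]_w psi (x + W theta (grid k) w) = heat k psi x.
Proof.
move=> kK bpsi; rewrite -[in RHS](subn0 k) -(increment_law theta) //.
rewrite /Rintegral; congr fine; apply: ae_eq_integral => //.
- by apply/measurable_EFinP; case: (bm_shift x (W_measurable theta (grid_itv kK)) bpsi).
- apply/measurable_EFinP.
  by case: (bm_shift x (increment_measurable theta (leq0n _) kK) bpsi).
- have := brownian_start (W_brownian theta); apply: filterS => w W0 _.
  by rewrite /increment grid0 W0 subr0.
Qed.

Lemma bm_heat k (psi : rVm R d -> R) : (k <= K)%N -> bounded_measurable psi ->
  bounded_measurable (heat k psi : rVm R d -> R).
Proof.
move=> kK bpsi.
apply: (bm_fubini_F (T1 := rVm R d) P
  (F := fun z => psi ((z.1 : 'rV[R]_d) + increment theta0 0 k z.2))).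
apply: (bm_comp (h := fun z : rVm R d * Omega =>
  (z.1 : 'rV[R]_d) + increment theta0 0 k z.2 : rVm R d)) bpsi.
apply: measurable_rVmD => //.
exact: (measurableT_comp (increment_measurable theta0 (leq0n _) kK)).
Qed.

(** The semigroup property: the increment over [0, a + b] is the sum of those over [0, a] and
    [a, a + b], which are independent, and freezing the first leaves an application of [heat b]. *)
Lemma heat_heat a b (psi : rVm R d -> R) (x : 'rV[R]_d) : (a + b <= K)%N ->
  bounded_measurable psi -> heat a (heat b psi) x = heat (a + b)%N psi x.
Proof.
move=> abK bpsi.
have aK : (a <= K)%N by rewrite (leq_trans _ abK) // leq_addr.
pose t i := if i == 0%N then grid 0 else if i == 1%N then grid a else grid (a + b)%N.
have t0T i : 0 <= t i <= T by rewrite /t; case: ifP => _; [|case: ifP => _]; exact: grid_itv.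
have tm i : (i < 2)%N -> t i <= t i.+1.
  by case: i => [|[|]] // _; rewrite /t /= grid_le // leq_addr.
have ind := brownian_independent_increments (W_brownian theta0) (fun i _ => t0T i) tm.
pose D (i : nat) : set_system Omega :=
  \bigcup_(c in [set: 'I_d]) preimage_set_system setT
    (fun w => (W theta0 (t i.+1) w - W theta0 (t i) w) 0 c) measurable.
have DE i : sigma_rvec (fun w => W theta0 (t i.+1) w - W theta0 (t i) w) = <<s D i >>.
  by [].
have Dm i : D i `<=` measurable.
  move=> _ [c _ [B mB <-]].
  have h : measurable_fun setT
      ((fun w => W theta0 (t i.+1) w - W theta0 (t i) w) : Omega -> rVm R d).
    by apply: measurable_rVmB; exact: W_measurable.
  by apply: (measurableT_comp (rVm_coord c) h) => //.
have indD : independent2 P <<s D 0%N >> <<s D 1%N >>.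
  move=> A B DA DB.
  have := ind [:: 0%N; 1%N] isT _ (fun i => if i == 0%N then A else B) _.
  rewrite !big_cons big_nil mule1 /= => <-.
  - congr (P _); apply/seteqP; split=> [w [wA wB] i|w h].
      by rewrite /= !inE => /orP[]/eqP ->.
    by split; [exact: (h 0%N)|exact: (h 1%N)].
  - by move=> i; rewrite !inE => /orP[]/eqP ->.
  - by move=> i; rewrite !inE => /orP[]/eqP ->.
have mD i : measurable_fun setT
    ((fun w => W theta0 (t i.+1) w - W theta0 (t i) w) :
       g_sigma_algebraType (D i) -> rVm R d).
  apply: measurable_rVm => c _ B mB; apply: sub_sigma_algebra; exists c => //.
  by exists B.
rewrite -[in RHS](subn0 (a + b)%N) -(increment_law theta0) //.
have := freezing (Dm 0%N) (Dm 1%N) indD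
  (F := fun z => psi (x + increment theta0 0 a z.1 + increment theta0 a (a + b)%N z.2)).
have -> : (fun w => psi (x + increment theta0 0 (a + b)%N w)) =
    (fun w => psi (x + increment theta0 0 a w + increment theta0 a (a + b)%N w)).
  apply/funext => w; congr psi; rewrite /increment -addrA; congr (_ + _).
  by rewrite [RHS]addrC addrA subrK.
rewrite /= => ->; last first.
  apply: (bm_comp (h := fun z : g_sigma_algebraType (D 0%N) * g_sigma_algebraType (D 1%N) =>
    x + increment theta0 0 a z.1 + increment theta0 a (a + b)%N z.2 : rVm R d)) bpsi.
  apply: measurable_rVmD; last exact: (measurableT_comp (mD 1%N)).
  by apply: measurable_rVmD => //; exact: (measurableT_comp (mD 0%N)).
rewrite {1}/heat; apply: eq_Rintegral => w _.
by rewrite increment_law ?leq_addr // addKn.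
Qed.

Definition level (k : nat) (theta : Theta) (w : Omega) : nat :=
  Num.truncn (k%:R * r theta w).

Lemma level_lt k theta w : (0 < k)%N -> (level k theta w < k)%N.
Proof.
move=> k0; have /andP[r0 r1] := r_range theta w.
have k0R : 0 < k%:R :> R by rewrite ltr0n.
have /truncn_itv/andP[h1 _] : 0 <= k%:R * r theta w by rewrite mulr_ge0 ?ltW.
by rewrite -(ltr_nat R) (le_lt_trans h1) // gtr_pMr.
Qed.

Lemma level_le k theta w : (level k theta w <= k)%N.
Proof.
by case: k => [|k]; [rewrite /level mul0r truncn0|rewrite ltnW // level_lt].
Qed.

Definition cell (k i : nat) : set R := [set y | Num.truncn (k%:R * y) = i].

Lemma measurable_cell k i : measurable (cell k i).
Proof.
have mk : measurable_fun setT (fun y : R => k%:R * y) by exact: measurable_funM.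
have mle n : measurable [set y : R | (Num.truncn (k%:R * y) <= n)%N].
  rewrite (_ : [set y | _] = (fun y : R => k%:R * y) @^-1` [set` `]-oo, n.+1%:R[]).
    by rewrite -[X in measurable X]setTI; exact: mk.
  by apply/seteqP; split=> y; rewrite /= in_itv /= truncn_le_nat.
case: i => [|i].
  rewrite (_ : cell k 0 = [set y : R | (Num.truncn (k%:R * y) <= 0)%N]) //.
  by apply/seteqP; split=> y; rewrite /cell /= leqn0 => /eqP.
rewrite (_ : cell k i.+1 = [set y : R | (Num.truncn (k%:R * y) <= i.+1)%N] `\`
   [set y : R | (Num.truncn (k%:R * y) <= i)%N]); first exact: measurableD.
apply/seteqP; split=> y; rewrite /cell /=.
  by move=> ->; rewrite leqnn ltnn.
move=> [h1 /negP]; rewrite -ltnNge => h2.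
by apply/eqP; rewrite eqn_leq h1 h2.
Qed.

Definition in_cell k i theta (w : Omega) : R := \1_(cell k i) (r theta w).

Lemma in_cellE k i theta w : in_cell k i theta w = (level k theta w == i)%:R.
Proof.
rewrite /in_cell indicE /cell /level; congr (nat_of_bool _)%:R.
by apply/idP/eqP => [|h]; rewrite inE.
Qed.

Lemma in_cell_source (D : set Theta) k i theta : D theta ->
  measurable_fun setT (in_cell k i theta : g_sigma_algebraType (sources D) -> R).
Proof.
move=> Dt; have mc := @measurable_indic _ _ R setT _ (measurable_cell k i).
exact: (measurableT_comp mc (r_source Dt)).
Qed.

Lemma int_in_cell k i theta : (i < k)%N ->
  \int[P]_w in_cell k i theta w = k%:R^-1.
Proof.
move=> ik; have [mc Pc] := r_cell theta ik.
rewrite /Rintegral (_ : (fun w => _) =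
  (fun w => (\1_[set w | level k theta w = i] w)%:E)).
  rewrite integral_indic // setIT; change (fine (P [set w | level k theta w = i]) = k%:R^-1).
  by rewrite Pc.
by apply/funext => w; rewrite in_cellE indicE; congr (nat_of_bool _)%:R%:E;
  apply/eqP/idP; rewrite inE.
Qed.

Lemma bm_frozen (D : set Theta) (F : 'rV[R]_d -> Omega -> R) :
  bounded_measurable (fun z : rVm R d * g_sigma_algebraType (sources D) => F z.1 z.2) ->
  bounded_measurable ((fun y => \int[P]_w F y w) : rVm R d -> R).
Proof.
move=> bF; apply: (bm_fubini_F (T1 := rVm R d) P (F := fun z => F z.1 z.2)).
have m1 : measurable_fun [set: rVm R d * Omega] (fst : rVm R d * Omega -> rVm R d) by [].
have m2 := measurableT_comp (g_sigma_id_measurable (sources_sub (D := D)))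
  (measurable_snd : measurable_fun setT (snd : rVm R d * Omega -> Omega)).
exact: (bm_comp (measurable_fun_pair m1 m2) bF).
Qed.

(** * Evaluation at a random time level *)

Section randomized.
Variables (theta1 : Theta) (D : set Theta) (k : nat).
Variable G : nat -> 'rV[R]_d -> Omega -> R.
Hypotheses (kK : (k <= K)%N)
  (bG : forall i, (i <= K)%N -> bounded_measurable
    (fun z : rVm R d * g_sigma_algebraType (sources D) => G i z.1 z.2)).

Let lev := level k theta1.

(** The random level becomes a finite sum over deterministic levels, to which measurability and
    linearity apply. The summand [i = k] is only ever selected for [k = 0]. *)
Lemma randomized_split (x : 'rV[R]_d) w :
  G (lev w) (x + increment theta1 (lev w) k w) w =
  \sum_(i < k.+1) in_cell k i theta1 w * G i (x + increment theta1 i k w) w.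
Proof.
have lk : (lev w < k.+1)%N by rewrite ltnS level_le.
rewrite (bigD1 (Ordinal lk)) //= in_cellE eqxx mul1r big1 ?addr0 // => i il.
by rewrite in_cellE; case: eqP => [h|]; [case/eqP: il; exact: val_inj|rewrite mul0r].
Qed.

Lemma bm_randomized (E : set Theta) : E theta1 -> D `<=` E ->
  bounded_measurable (fun z : rVm R d * g_sigma_algebraType (sources E) =>
    G (lev z.2) ((z.1 : 'rV[R]_d) + increment theta1 (lev z.2) k z.2) z.2).
Proof.
move=> E1 DE; under eq_fun do rewrite randomized_split.
apply: bm_sum => i _; have iK : (i <= K)%N by rewrite (leq_trans _ kK) // -ltnS.
apply: bmM.
  split; last by exists 1 => z; rewrite in_cellE; case: eqP => _; rewrite ?normr1 ?normr0.
  exact: (measurableT_comp (in_cell_source k i E1)).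
apply: (bm_comp (h := fun z : rVm R d * g_sigma_algebraType (sources E) =>
  ((z.1 : 'rV[R]_d) + increment theta1 i k z.2 : rVm R d,
   z.2 : g_sigma_algebraType (sources D)))) (bG iK).
apply: measurable_fun_pair; last exact: (measurableT_comp (sources_mono DE) measurable_snd).
by apply: measurable_rVmD => //; exact: (measurableT_comp (increment_source E1 iK kK)).
Qed.

(** Both variables belong to the same index [theta1], so disjointness of index sets cannot separate
    them; the independence of all uniform variables from all Brownian motions does. *)
Lemma indep_cell_increment i (psi : rVm R d -> R) (x : 'rV[R]_d) : (i <= K)%N ->
  bounded_measurable psi ->
  indep_rv P (in_cell k i theta1) (fun w => psi (x + increment theta1 i k w)).
Proof.
move=> iK bpsi.
pose A : set_system Omega := \bigcup_(_ in [set: unit])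
  preimage_set_system setT (r theta1) measurable.
pose B : set_system Omega := \bigcup_(ti in [set ti : R * 'I_d | 0 <= ti.1 <= T])
  preimage_set_system setT (fun w => W theta1 ti.1 w 0 ti.2) measurable.
have Am : A `<=` measurable by move=> _ [_ _ [C mC <-]]; exact: r_meas.
have Bm : B `<=` measurable.
  move=> _ [[t c] /= tT [C mC <-]].
  exact: (brownian_measurable (W_brownian theta1) c tT).
exists A, B; split => //.
- apply: independent2_sub r_W_indep.
  + by apply: sigma_rv_sub => _ _; exists theta1.
  + by move=> C CB; apply: sub_sigma_algebra; exists theta1.
- have mc := @measurable_indic _ _ R setT _ (measurable_cell k i).
  have mr : measurable_fun setT (r theta1 : g_sigma_algebraType A -> R).
    by move=> _ C mC; apply: sub_sigma_algebra; exists tt => //; exists C.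
  exact: (measurableT_comp mc mr).
- have mW j : (j <= K)%N ->
      measurable_fun setT (W theta1 (grid j) : g_sigma_algebraType B -> rVm R d).
    move=> jK; apply: measurable_rVm => c _ C mC; apply: sub_sigma_algebra.
    by exists (grid j, c); [exact: grid_itv|exists C].
  have mI : measurable_fun setT (increment theta1 i k : g_sigma_algebraType B -> rVm R d).
    by apply: measurable_rVmB; exact: mW.
  by case: (bm_shift x mI bpsi).
Qed.

(* Freezing the sources in [D] leaves the random level and the increment of W,
   which are independent for each value of the level. *)
Lemma randomized_int (x : 'rV[R]_d) : ~ D theta1 ->
  k%:R * \int[P]_w G (lev w) (x + increment theta1 (lev w) k w) w =
  \sum_(i < k) heat (k - i) (fun y => \int[P]_w G i y w) x.
Proof.
move=> nD; have [->|k0] := posnP k; first by rewrite mul0r big_ord0.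
have D1 : [set theta1] theta1 by [].
have bF i : (i <= K)%N -> bounded_measurable
    (fun z : g_sigma_algebraType (sources [set theta1]) * g_sigma_algebraType (sources D) =>
      in_cell k i theta1 z.1 * G i (x + increment theta1 i k z.1) z.2).
  move=> iK; apply: bmM.
    split; last by exists 1 => z; rewrite in_cellE; case: eqP => _; rewrite ?normr1 ?normr0.
    exact: (measurableT_comp (in_cell_source k i D1)).
  apply: (bm_comp (h := fun z : g_sigma_algebraType (sources [set theta1])
      * g_sigma_algebraType (sources D) =>
    (x + increment theta1 i k z.1 : rVm R d, z.2))) (bG iK).
  apply: measurable_fun_pair => //.
  by apply: measurable_rVmD => //; exact: (measurableT_comp (increment_source D1 iK kK)).
have bFd i : (i <= K)%N -> bounded_measurable
    (fun w : Omega => in_cell k i theta1 w * G i (x + increment theta1 i k w) w).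
  move=> iK; have m1 := g_sigma_id_measurable (sources_sub (D := [set theta1])).
  have m2 := g_sigma_id_measurable (sources_sub (D := D)).
  exact: (bm_comp (measurable_fun_pair m1 m2) (bF i iK)).
rewrite (_ : (fun w => _) = fun w =>
  \sum_(i < k) in_cell k i theta1 w * G i (x + increment theta1 i k w) w); last first.
  apply/funext => w; rewrite randomized_split big_ord_recr /= in_cellE.
  by rewrite (ltn_eqF (level_lt _ _ k0)) mul0r addr0.
have bFd' (i : 'I_k) : bounded_measurable
    (fun w : Omega => in_cell k i theta1 w * G i (x + increment theta1 i k w) w).
  by apply: bFd; rewrite (leq_trans (ltnW (ltn_ord i))).
rewrite bm_int_sum // mulr_sumr; apply: eq_bigr => i _.
have iK : (i <= K)%N by rewrite (leq_trans (ltnW (ltn_ord i))).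
have ind : independent2 P <<s sources [set theta1] >> <<s sources D >>.
  by apply: sources_independent => t /= ->.
rewrite (freezing (sources_sub (D := _)) (sources_sub (D := _)) ind (bF i iK)) /=.
have bG' y : bounded_measurable (fun w : Omega => G i y w).
  have m1 : measurable_fun [set: Omega] (fun=> y : rVm R d) by [].
  have m2 := g_sigma_id_measurable (sources_sub (D := D)).
  exact: (bm_comp (measurable_fun_pair m1 m2) (bG iK)).
rewrite (_ : (fun w1 => _) = fun w1 => in_cell k i theta1 w1 *
    (fun y => \int[P]_w G i y w) (x + increment theta1 i k w1)); last first.
  by apply/funext => w; rewrite bm_intZ.
rewrite indep_rvM; first last.
- exact: (bm_shift x (increment_measurable theta1 iK kK) (bm_frozen (bG iK))).
- split; last by exists 1 => z; rewrite in_cellE; case: eqP => _; rewrite ?normr1 ?normr0.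
  exact: sub_g_sigma_measurable (sources_sub (D := _)) (in_cell_source k i D1).
- exact: (indep_cell_increment x iK (bm_frozen (bG iK))).
(* The prefactor k cancels the probability 1 / k of each cell. *)
rewrite (int_in_cell theta1 (ltn_ord i)).
rewrite (increment_law theta1 x (ltnW (ltn_ord i)) kK (bm_frozen (bG iK))).
have kn0 : k%:R != 0 :> R by rewrite pnatr_eq0 -lt0n.
by rewrite mulrA (mulfV kn0) mul1r.
Qed.

End randomized.

Lemma heatD k (psi phi : rVm R d -> R) (x : 'rV[R]_d) : (k <= K)%N ->
  bounded_measurable psi -> bounded_measurable phi ->
  heat k (fun y => psi y + phi y) x = heat k psi x + heat k phi x.
Proof.
move=> kK b1 b2; rewrite /heat bm_intD //.
- exact: bm_shift (increment_measurable theta0 (leq0n _) kK) b1.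
- exact: bm_shift (increment_measurable theta0 (leq0n _) kK) b2.
Qed.

Lemma heatZ k (c : R) (psi : rVm R d -> R) (x : 'rV[R]_d) : (k <= K)%N ->
  bounded_measurable psi -> heat k (fun y => c * psi y) x = c * heat k psi x.
Proof.
move=> kK b1; rewrite /heat bm_intZ //.
exact: bm_shift (increment_measurable theta0 (leq0n _) kK) b1.
Qed.

Lemma heatB k (psi phi : rVm R d -> R) (x : 'rV[R]_d) : (k <= K)%N ->
  bounded_measurable psi -> bounded_measurable phi ->
  heat k (fun y => psi y - phi y) x = heat k psi x - heat k phi x.
Proof.
move=> kK b1 b2; rewrite /heat bm_intB //.
- exact: bm_shift (increment_measurable theta0 (leq0n _) kK) b1.
- exact: bm_shift (increment_measurable theta0 (leq0n _) kK) b2.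
Qed.

Lemma heat_sum k (I : eqType) (s : seq I) (psi : I -> rVm R d -> R) (x : 'rV[R]_d) :
  (k <= K)%N -> (forall i, i \in s -> bounded_measurable (psi i)) ->
  heat k (fun y => \sum_(i <- s) psi i y) x = \sum_(i <- s) heat k (psi i) x.
Proof.
move=> kK b1; rewrite /heat bm_int_sum // => i si.
exact: bm_shift (increment_measurable theta0 (leq0n _) kK) (b1 _ si).
Qed.

Lemma heat_le_cst k (psi : rVm R d -> R) (x : 'rV[R]_d) (c : R) : (k <= K)%N ->
  bounded_measurable psi -> (forall y, psi y <= c) -> heat k psi x <= c.
Proof.
move=> kK b1 hc; rewrite /heat -[leRHS](bm_int_cst P c); apply: bm_int_le => //.
- exact: bm_shift (increment_measurable theta0 (leq0n _) kK) b1.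
- exact: bm_cst.
Qed.

Lemma heat_cst k (x : 'rV[R]_d) (c : R) : heat k (fun=> c) x = c.
Proof. by rewrite /heat bm_int_cst. Qed.

Lemma heat_sqr k (psi : rVm R d -> R) (x : 'rV[R]_d) : (k <= K)%N ->
  bounded_measurable psi -> heat k psi x ^+ 2 <= heat k (fun y => psi y ^+ 2) x.
Proof.
move=> kK b1; apply: bm_sqr_int.
exact: bm_shift (increment_measurable theta0 (leq0n _) kK) b1.
Qed.

(** * The exact recursion *)

Context (L : R) (L_gt0 : 0 < L) (f : R -> R) (f_cont : continuous f)
  (f_lip : forall a b : R, `|f a - f b| <= L * `|a - b|).

Lemma f_measurable : measurable_fun setT f.
Proof. exact: continuous_measurable_fun. Qed.

Lemma f_growth a : `|f a| <= `|f 0| + L * `|a|.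
Proof.
rewrite -[X in `|X|](subrK (f 0)) addrC (le_trans (ler_normD _ _)) // lerD2l.
by rewrite (le_trans (f_lip _ _)) // subr0.
Qed.

Lemma f_lip_sqr a b : (f a - f b) ^+ 2 <= L ^+ 2 * (a - b) ^+ 2.
Proof.
rewrite -[leLHS]real_normK ?num_real // -[X in _ * X]real_normK ?num_real // -exprMn.
by rewrite ler_pXn2r // nnegrE ?mulr_ge0 // ltW.
Qed.

Lemma bm_f d' (U : measurableType d') (g : U -> R) :
  bounded_measurable g -> bounded_measurable (fun u => f (g u)).
Proof.
move=> [mg [B gB]]; split; first exact: measurableT_comp f_measurable mg.
exists (`|f 0| + L * B) => u; rewrite (le_trans (f_growth _)) // lerD2l.
by rewrite ler_pM2l.
Qed.

Context (v : nat -> 'rV[R]_d -> R)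
  (v_cont : forall k, (k <= K)%N -> continuous (v k))
  (v0_bound : forall x, `|v 0%N x| <= L)
  (v_rec : forall k x, (1 <= k <= K)%N ->
     (v k x)%:E =
       'E_P[fun w => (v k.-1 (x + W theta0 (T / K%:R) w)
                      + T / K%:R * f (v k.-1 (x + W theta0 (T / K%:R) w)))%R]%E).

Let h : R := T / K%:R.

Lemma h_gt0 : 0 < h.
Proof. by rewrite divr_gt0 // ltr0n. Qed.

Lemma grid1 : grid 1 = h.
Proof. by rewrite /grid mul1r. Qed.

Lemma gridE k : grid k = k%:R * h.
Proof. by rewrite /grid /h mulrA. Qed.

(** Boundedness of [v k] is a premise because it is itself obtained by an induction that passes
    through this identity. *)
Lemma v_step_bm k : (k < K)%N -> bounded_measurable (v k : rVm R d -> R) ->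
  forall x, v k.+1 x = heat 1 (fun y => v k y + h * f (v k y)) x.
Proof.
move=> kK bv x; apply: EFin_inj; rewrite v_rec //= unlock -grid1.
have b2 : bounded_measurable ((fun y => v k y + grid 1 * f (v k y)) : rVm R d -> R).
  by apply: bmD => //; apply: bmZ; exact: bm_f.
rewrite -(W_grid_law theta0 x (leq_ltn_trans (leq0n _) kK) b2) bm_EFin //.
  by rewrite grid1.
exact: bm_shift (W_measurable _ (grid_itv (leq_ltn_trans (leq0n _) kK))) b2.
Qed.

(** By the linear growth of [f], one step maps a bound B to (1 + L h) B + h |f 0|; the right-hand
    side is a supersolution of this recursion started at L. *)
Lemma v_bound_k k : (k <= K)%N -> bounded_measurable (v k : rVm R d -> R) /\
  forall x, `|v k x| <= (1 + L * h) ^+ k * (L + k%:R * h * `|f 0|).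
Proof.
have q1 : 1 <= 1 + L * h by rewrite lerDl mulr_ge0 // ltW // h_gt0.
elim: k => [_|k ih kK].
  split; last by move=> x; rewrite expr0 mul1r !mul0r addr0.
  by split; [exact: continuous_rVm_measurable (v_cont _)|exists L].
have [bv vB] := ih (ltnW kK).
set B := (1 + L * h) ^+ k * _ in vB.
have b2 : bounded_measurable ((fun y => v k y + h * f (v k y)) : rVm R d -> R).
  by apply: bmD => //; apply: bmZ; exact: bm_f.
have bnd x : `|v k.+1 x| <= (1 + L * h) ^+ k.+1 * (L + k.+1%:R * h * `|f 0|).
  have K1 : (1 <= K)%N by rewrite (leq_ltn_trans _ kK).
  rewrite v_step_bm //; apply: bm_int_norm.
    exact: bm_shift (increment_measurable theta0 (leq0n _) K1) b2.
  move=> w; set y := (X in v k X).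
  have h1 : `|v k y + h * f (v k y)| <= B + h * (`|f 0| + L * B).
    rewrite (le_trans (ler_normD _ _)) // lerD ?vB // normrM gtr0_norm ?h_gt0 //.
    rewrite ler_pM2l ?h_gt0 // (le_trans (f_growth _)) // lerD2l ler_pM2l //.
  apply: (le_trans h1); rewrite exprS -mulrA -/B.
  have -> : (1 + L * h) * ((1 + L * h) ^+ k * (L + k.+1%:R * h * `|f 0|)) =
    (1 + L * h) * B + (1 + L * h) ^+ k.+1 * (h * `|f 0|).
    by rewrite /B exprS -natr1; ring.
  have q2 : 1 <= (1 + L * h) ^+ k.+1 by rewrite exprn_ege1.
  have hf : 0 <= h * `|f 0| by rewrite mulr_ge0 // ltW // h_gt0.
  have : h * `|f 0| <= (1 + L * h) ^+ k.+1 * (h * `|f 0|) by rewrite ler_peMl.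
  lra.
split => //; split; first exact: continuous_rVm_measurable (v_cont _).
by exists ((1 + L * h) ^+ k.+1 * (L + k.+1%:R * h * `|f 0|)).
Qed.

Lemma bm_v k : (k <= K)%N -> bounded_measurable (v k : rVm R d -> R).
Proof. by move=> kK; have [] := v_bound_k kK. Qed.

(** Uniform in d and K because (1 + L h)^k <= exp(L k h) and k h <= T. *)
Lemma v_bound k x : (k <= K)%N -> `|v k x| <= expR (L * T) * (L + T * `|f 0|).
Proof.
move=> kK; have [_ vB] := v_bound_k kK; apply: (le_trans (vB x)).
have kh : k%:R * h <= T.
  by have /andP[_] := grid_itv kK; rewrite gridE.
have hp := h_gt0.
apply: ler_pM.
- by rewrite exprn_ge0 // addr_ge0 // mulr_ge0 // ltW.
- by rewrite addr_ge0 ?(ltW L_gt0) // !mulr_ge0 // ltW.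
- apply: (@le_trans _ _ (expR (L * h) ^+ k)).
    rewrite lerXn2r ?nnegrE ?expR_ge0 //; last exact: expR_ge1Dx.
    by rewrite addr_ge0 // mulr_ge0 // ltW.
  rewrite -expRM_natl ler_expR mulrCA ler_pM2l //.
- by rewrite lerD2l ler_wpM2r.
Qed.

Lemma v_step k x : (k < K)%N ->
  v k.+1 x = heat 1 (v k) x + h * heat 1 (fun y => f (v k y)) x.
Proof.
move=> kK; have bv := bm_v (ltnW kK); have K1 := leq_ltn_trans (leq0n _) kK.
by rewrite v_step_bm // heatD // ?heatZ //; [exact: bm_f|apply: bmZ; exact: bm_f].
Qed.

(** Discrete Duhamel formula. A further step applies [heat 1] to the formula at time k; the
    semigroup property lengthens every transition by one, and the term [i = k] is new. *)
Lemma v_repr k x : (k <= K)%N ->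
  v k x = heat k (v 0%N) x +
    h * \sum_(i < k) heat (k - i) (fun y => f (v i y)) x.
Proof.
elim: k x => [x _|k ih x kK].
  rewrite big_ord0 mulr0 addr0 /heat.
  under eq_Rintegral do rewrite /increment subrr addr0.
  by rewrite bm_int_cst.
have K1 : (1 <= K)%N by rewrite (leq_ltn_trans _ kK).
have kK' := ltnW kK.
have iK (i : 'I_k) : (i <= K)%N by rewrite (leq_trans (ltnW (ltn_ord i))).
have kiK i : (k - i <= K)%N by rewrite (leq_trans (leq_subr _ _)).
rewrite v_step //.
have -> : v k = fun y => heat k (v 0%N) y +
    h * \sum_(i < k) heat (k - i) (fun y => f (v i y)) y.
  by apply/funext => y; rewrite ih.
have bi (i : 'I_k) : bounded_measurable
    (heat (k - i) (fun y => f (v i y)) : rVm R d -> R).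
  by apply: bm_heat => //; apply: bm_f; exact: bm_v.
have bs : bounded_measurable ((fun y => \sum_(i < k) heat (k - i) (fun y => f (v i y)) y)
    : rVm R d -> R) by exact: bm_sum.
rewrite heatD //; [|by apply: bm_heat => //; exact: bm_v|exact: bmZ].
rewrite heatZ // heat_sum // heat_heat //; last exact: bm_v.
rewrite add1n big_ord_recr /= mulrDr addrA; congr (_ + _ * _ + _).
- apply: eq_bigr => i _; rewrite heat_heat.
  + by rewrite add1n subSn // ltnW.
  + by rewrite add1n (leq_trans _ kK) // ltnS leq_subr.
  + by apply: bm_f; exact: bm_v.
- rewrite subSnn; congr (h * heat 1 _ x); apply/funext => y; congr f.
  by rewrite ih.
Qed.

(** * Variables adapted to disjoint sets of sources *)

Definition adapted (D : set Theta) (X : Omega -> R) :=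
  bounded_measurable (X : g_sigma_algebraType (sources D) -> R).

Lemma adapted_mono (D E : set Theta) X : D `<=` E -> adapted D X -> adapted E X.
Proof. by move=> DE; exact: bm_comp (sources_mono DE). Qed.

Lemma adapted_bm D X : adapted D X -> bounded_measurable X.
Proof. exact: bm_comp (g_sigma_id_measurable (sources_sub (D := D))). Qed.

Lemma adapted_indep_rv (D E : set Theta) X Y :
  (forall t, D t -> E t -> False) -> adapted D X -> adapted E Y -> indep_rv P X Y.
Proof.
move=> DE [mX _] [mY _]; exists (sources D), (sources E); split => //.
- exact: sources_sub.
- exact: sources_sub.
- exact: sources_independent.
Qed.

Section independent_sum.
Context (I : eqType) (s : seq I) (D : I -> set Theta) (X : I -> Omega -> R).
Hypothesis disj : forall p q, p \in s -> q \in s -> p != q ->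
  forall t, D p t -> D q t -> False.
Hypothesis adX : forall p, p \in s -> adapted (D p) (X p).

Lemma adapted_sum : adapted [set t | exists2 q, q \in s & D q t]
  (fun w => \sum_(p <- s) X p w).
Proof.
apply: bm_sum => p ps; apply: adapted_mono (adX ps) => t Dt; by exists p.
Qed.

End independent_sum.

Lemma indep_cons (I : eqType) (p : I) (s : seq I) (D : I -> set Theta)
    (X : I -> Omega -> R) : uniq (p :: s) ->
  (forall q q', q \in p :: s -> q' \in p :: s -> q != q' ->
     forall t, D q t -> D q' t -> False) ->
  (forall q, q \in p :: s -> adapted (D q) (X q)) ->
  indep_rv P (X p) (fun w => \sum_(q <- s) X q w).
Proof.
move=> /= /andP[ps us] disj adX.
have adXs q : q \in s -> adapted (D q) (X q).
  by move=> qs; apply: adX; rewrite inE qs orbT.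
apply: (adapted_indep_rv _ (adX _ (mem_head _ _)) (adapted_sum adXs)).
move=> t Dp [q qs Dq]; apply: (disj p q _ _ _ t) => //.
- exact: mem_head.
- by rewrite inE qs orbT.
- by apply: contraNneq ps => ->.
Qed.

(** Bienaymé's identity: the head of the list is independent of the sum over the tail, so the
    centred cross term has mean zero. *)
Lemma variance_sum (I : eqType) (s : seq I) (D : I -> set Theta)
    (X : I -> Omega -> R) : uniq s ->
  (forall q q', q \in s -> q' \in s -> q != q' ->
     forall t, D q t -> D q' t -> False) ->
  (forall q, q \in s -> adapted (D q) (X q)) ->
  \int[P]_w (\sum_(p <- s) X p w - \int[P]_w' \sum_(p <- s) X p w') ^+ 2 =
  \sum_(p <- s) \int[P]_w (X p w - \int[P]_w' X p w') ^+ 2.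
Proof.
elim: s => [|p s ih] us disj adX.
  rewrite big_nil -[RHS](bm_int_cst P 0); apply: eq_Rintegral => w _.
  rewrite big_nil sub0r sqrrN -[X in X ^+ 2]/(\int[P]_w' _).
  rewrite (_ : (fun w' => _) = fun=> 0) ?bm_int_cst ?expr0n //.
  by apply/funext => w'; rewrite big_nil.
have adXs q : q \in s -> adapted (D q) (X q).
  by move=> qs; apply: adX; rewrite inE qs orbT.
have ind := indep_cons us disj adX.
have bX := adapted_bm (adX _ (mem_head _ _)).
have bS := adapted_bm (adapted_sum adXs).
rewrite big_cons -ih //; first last.
- by move=> q q' qs q's; apply: disj; rewrite inE ?qs ?q's orbT.
- by case/andP: us.
set S := fun w => \sum_(q <- s) X q w.
set a := \int[P]_w X p w; set b := \int[P]_w S w.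
have -> : \int[P]_w (\sum_(q <- p :: s) X q w) = a + b.
  by rewrite -bm_intD //; apply: eq_Rintegral => w _; rewrite big_cons.
have bXa : bounded_measurable (fun w => X p w - a) by apply: bmB => //; exact: bm_cst.
have bSb : bounded_measurable (fun w => S w - b) by apply: bmB => //; exact: bm_cst.
have -> : (fun w => (\sum_(q <- p :: s) X q w - (a + b)) ^+ 2) =
   (fun w => (X p w - a) ^+ 2 + ((S w - b) ^+ 2 + 2 * ((X p w - a) * (S w - b)))).
  by apply/funext => w; rewrite big_cons /S; ring.
rewrite bm_intD; [|exact: bmX|by apply: bmD; [exact: bmX|apply: bmZ; exact: bmM]].
rewrite bm_intD; [|exact: bmX|by apply: bmZ; exact: bmM].
rewrite bm_intZ; last exact: bmM.
suff -> : \int[P]_w ((X p w - a) * (S w - b)) = 0 by rewrite mulr0 addr0.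
have [A [B [Am Bm AB mX mS]]] := ind.
rewrite (@indep_rvM _ _ _ P (fun w => X p w - a) (fun w => S w - b)) //.
  by rewrite bm_intB //; [rewrite bm_int_cst -/a subrr mul0r|exact: bm_cst].
by exists A, B; split => //; [apply: measurable_funB mX _|apply: measurable_funB mS _].
Qed.

Lemma eqlaw_sum (I : eqType) (s : seq I) (D D' : I -> set Theta)
    (X X' : I -> Omega -> R) : uniq s ->
  (forall q q', q \in s -> q' \in s -> q != q' ->
     forall t, D q t -> D q' t -> False) ->
  (forall q q', q \in s -> q' \in s -> q != q' ->
     forall t, D' q t -> D' q' t -> False) ->
  (forall q, q \in s -> adapted (D q) (X q)) ->
  (forall q, q \in s -> adapted (D' q) (X' q)) ->
  (forall q, q \in s -> eqlaw P (X q) (X' q)) ->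
  eqlaw P (fun w => \sum_(p <- s) X p w) (fun w => \sum_(p <- s) X' p w).
Proof.
elim: s => [|p s ih] us disj disj' adX adX' XX'.
  by move=> phi _; apply: eq_Rintegral => w _; rewrite !big_nil.
have E (Y : I -> Omega -> R) :
  (fun w => \sum_(q <- p :: s) Y q w) = fun w => Y p w + \sum_(q <- s) Y q w.
  by apply/funext => w; rewrite big_cons.
rewrite !E.
apply: eqlawD.
- exact: indep_cons disj adX.
- exact: indep_cons disj' adX'.
- by apply: XX'; exact: mem_head.
- apply: ih.
  + by case/andP: us.
  + by move=> q q' qs q's; apply: disj; rewrite inE ?qs ?q's orbT.
  + by move=> q q' qs q's; apply: disj'; rewrite inE ?qs ?q's orbT.
  + by move=> q qs; apply: adX; rewrite inE qs orbT.
  + by move=> q qs; apply: adX'; rewrite inE qs orbT.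
  + by move=> q qs; apply: XX'; rewrite inE qs orbT.
Qed.

(* [V theta] only uses the sources in [below theta], and its sample indexed by
   [p = (j, m)] only those in [block theta p]. *)
Definition below (theta : Theta) : set Theta :=
  [set t | exists2 s, s != [::] & val t = val theta ++ s].

(** The absolute value gathers the subtrees of (theta, j, m) and (theta, j, -m), which one sample
    uses together. The list [s] may be empty, as the sources at these two nodes count too. *)
Definition block (theta : Theta) (p : nat * nat) : set Theta :=
  [set t | exists (e : int) (s : seq int),
    `|e|%N = p.2 /\ val t = val theta ++ p.1%:Z :: e :: s].

Lemma block_below theta p : block theta p `<=` below theta.
Proof. by move=> t [e [s [_ E]]]; exists (p.1%:Z :: e :: s). Qed.

Lemma append2_block theta (j m : nat) (e : int) : `|e|%N = m ->
  block theta (j, m) (append2 theta j%:Z e).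
Proof. by move=> em; exists e, [::]. Qed.

Lemma below_append2_block theta (j m : nat) (e : int) : `|e|%N = m ->
  below (append2 theta j%:Z e) `<=` block theta (j, m).
Proof. by move=> em t [s _ E]; exists e, s; split => //; rewrite E /= -catA. Qed.

Lemma cat_inj (A : Type) (s t t' : seq A) : s ++ t = s ++ t' -> t = t'.
Proof. by elim: s => //= a s ih [/ih]. Qed.

Lemma block_disjoint theta p q t : p != q -> block theta p t -> block theta q t -> False.
Proof.
move=> pq [e [s [ep E]]] [e' [s' [eq' ]]]; rewrite E => /cat_inj[] pq1 ee' _.
by case/eqP: pq; clear E; case: p q ep eq' pq1 => [p1 p2] [q1 q2] /= <- <- ->; rewrite ee'.
Qed.

Lemma below_append2_disjoint theta (j : int) (e e' : int) t : e != e' ->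
  below (append2 theta j e) t -> below (append2 theta j e') t -> False.
Proof.
move=> ee' [s _ E] [s' _]; rewrite E /= -!catA => /cat_inj[] E' _.
by move: ee'; rewrite E' eqxx.
Qed.

(** Here the strictness of [below] matters: level and increment come from the node itself, the
    approximations from proper extensions of it and of its mirror image. *)
Lemma not_below_append2 theta (j : int) (e e' : int) :
  ~ below (append2 theta j e') (append2 theta j e).
Proof.
move=> [s s0 /=]; rewrite -catA => /cat_inj[] _.
by case: s s0.
Qed.

(** * The multilevel Picard scheme *)

Context (M : nat) (M_gt0 : (0 < M)%N)
  (V : Theta -> nat -> nat -> 'rV[R]_d -> Omega -> R)
  (V_rec : forall (n k : nat) (theta : Theta) (x : 'rV[R]_d) (w : Omega),
     (k <= K)%N ->
     V theta k n x w =
       (0 < n)%N%:R / M%:R ^+ n *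
         (\sum_(1 <= m < (M ^ n).+1)
            (v 0%N (x + W (append2 theta 0 (- m%:Z)) (k%:R * T / K%:R) w)
             + k%:R * T / K%:R * f 0))
       + \sum_(1 <= j < n) k%:R * T / (K%:R * M%:R ^+ (n - j)) *
         (\sum_(1 <= m < (M ^ (n - j)).+1)
            let theta1 := append2 theta j%:Z m%:Z in
            let theta2 := append2 theta j%:Z (- m%:Z) in
            let l := Num.truncn (k%:R * r theta1 w) in
            let y := x + W theta1 (k%:R * T / K%:R) w
                       - W theta1 (l%:R * T / K%:R) w in
            (f (V theta1 l j y w) - f (V theta2 l j.-1 y w)))).

Definition correction theta (p : nat * nat) (i : nat) (y : 'rV[R]_d) (w : Omega) : R :=
  f (V (append2 theta p.1%:Z p.2%:Z) i p.1 y w) -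
  f (V (append2 theta p.1%:Z (- p.2%:Z)) i p.1.-1 y w).

(* The pairs [(0, m)] index the samples of the terminal value [v 0], which uses the
   source [(theta, 0, -m)]. *)
Definition sample theta k (p : nat * nat) (x : 'rV[R]_d) (w : Omega) : R :=
  let theta1 := append2 theta p.1%:Z p.2%:Z in
  if p.1 == 0%N then v 0%N (x + W (append2 theta 0 (- p.2%:Z)) (grid k) w) + grid k * f 0
  else correction theta p (level k theta1 w)
         (x + increment theta1 (level k theta1 w) k w) w.

Definition weight k n (p : nat * nat) : R :=
  if p.1 == 0%N then (M%:R ^+ n)^-1 else grid k / M%:R ^+ (n - p.1).

(** With [j = 0] standing for the terminal value, the sample count M^(n - j) is right for both sums
    of the recursion. For [n = 0] the list is empty, which reproduces the indicator in front of the
    first sum. *)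
Definition pairs n : seq (nat * nat) :=
  [seq (j, m) | j <- index_iota 0 n, m <- index_iota 1 (M ^ (n - j)).+1].

Lemma mem_pairs n p : p \in pairs n -> (p.1 < n)%N /\ (0 < p.2)%N.
Proof.
by move=> /allpairsPdep[j [m [jn mM ->]]]; move: jn mM; rewrite !mem_index_iota /= => -> /andP[].
Qed.

Lemma uniq_pairs n : uniq (pairs n).
Proof.
apply: allpairs_uniq_dep => //; first exact: iota_uniq.
- by move=> j _; exact: iota_uniq.
- by move=> [a b] [a' b'] _ _ /= [-> ->].
Qed.

Lemma big_pairs n (F : nat * nat -> R) : \sum_(p <- pairs n) F p =
  \sum_(0 <= j < n) \sum_(1 <= m < (M ^ (n - j)).+1) F (j, m).
Proof. by rewrite /pairs big_allpairs_dep. Qed.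

Lemma V_sum n k theta x w : (k <= K)%N ->
  V theta k n x w = \sum_(p <- pairs n) weight k n p * sample theta k p x w.
Proof.
move=> kK; rewrite V_rec // big_pairs; case: n => [|n].
  by rewrite ltnn mulr0n !mul0r add0r !big_geq.
rewrite [RHS]big_ltn // subn0 -/(grid k) mul1r mulr_sumr; congr (_ + _).
apply: eq_big_nat => j /andP[j0 jn]; rewrite mulr_sumr; apply: eq_bigr => m _.
rewrite /weight /sample /= gtn_eqF // invfM mulrA -/(grid k); congr (_ * _).
by rewrite /correction /= -addrA.
Qed.

Lemma V0 k theta x w : (k <= K)%N -> V theta k 0 x w = 0.
Proof. by move=> kK; rewrite V_sum // big_pairs big_geq. Qed.

(** The premise is the induction hypothesis of [V_bm]. It is joint in the space point and the
    sources because the recursion evaluates [V] at random points. *)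
Lemma correction_bm n theta p :
  (forall j theta i, (j < n)%N -> (i <= K)%N -> bounded_measurable
    (fun z : rVm R d * g_sigma_algebraType (sources (below theta)) =>
       V theta i j z.1 z.2)) ->
  (p.1 < n)%N -> forall i, (i <= K)%N -> bounded_measurable
    (fun z : rVm R d * g_sigma_algebraType (sources
       (below (append2 theta p.1%:Z p.2%:Z) `|` below (append2 theta p.1%:Z (- p.2%:Z)))) =>
       correction theta p i z.1 z.2).
Proof.
move=> bV pn i iK; set D := _ `|` _.
have sub e j : (j < n)%N -> below e `<=` D -> bounded_measurable
    (fun z : rVm R d * g_sigma_algebraType (sources D) => V e i j z.1 z.2).
  move=> jn eD; have m1 : measurable_fun setT
      (fst : rVm R d * g_sigma_algebraType (sources D) -> rVm R d) by [].
  have m2 := measurableT_comp (sources_mono eD)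
    (measurable_snd : measurable_fun setT
      (snd : rVm R d * g_sigma_algebraType (sources D) -> g_sigma_algebraType (sources D))).
  exact: (bm_comp (measurable_fun_pair m1 m2) (bV j e i jn iK)).
apply: bmB; apply: bm_f; apply: sub => //.
- by move=> t; left.
- by rewrite (leq_ltn_trans (leq_pred _)).
- by move=> t; right.
Qed.

Lemma corrections_below theta p :
  below (append2 theta p.1%:Z p.2%:Z) `|` below (append2 theta p.1%:Z (- p.2%:Z))
    `<=` block theta p.
Proof.
case: p => j m t [] /=; first exact: below_append2_block.
by apply: below_append2_block; rewrite abszN.
Qed.

Lemma sample_bm n theta k p :
  (forall j theta i, (j < n)%N -> (i <= K)%N -> bounded_measurable
    (fun z : rVm R d * g_sigma_algebraType (sources (below theta)) =>
       V theta i j z.1 z.2)) ->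
  (k <= K)%N -> (p.1 < n)%N -> bounded_measurable
    (fun z : rVm R d * g_sigma_algebraType (sources (block theta p)) =>
       sample theta k p z.1 z.2).
Proof.
move=> bV kK pn; rewrite /sample.
have blk1 : block theta p (append2 theta p.1%:Z p.2%:Z).
  by case: p {pn} => j m; exact: append2_block.
case: eqP => [p0|_]; last first.
  exact: (bm_randomized kK (correction_bm theta bV pn) blk1 (@corrections_below theta p)).
apply: bmD; last exact: bm_cst.
have blk0 : block theta p (append2 theta 0 (- p.2%:Z)).
  by case: p {pn blk1} p0 => j m /= ->; apply: append2_block; rewrite abszN.
have m1 := W_source blk0 (grid_itv kK).
apply: (bm_comp _ (bm_v (leq0n K))).
apply: (measurable_rVmD (X := fst)) => //.
exact: (measurableT_comp m1 measurable_snd).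
Qed.

Lemma V_bm n theta k : (k <= K)%N -> bounded_measurable
  (fun z : rVm R d * g_sigma_algebraType (sources (below theta)) =>
     V theta k n z.1 z.2).
Proof.
elim/ltn_ind: n theta k => n ih theta k kK.
have -> : (fun z : rVm R d * g_sigma_algebraType (sources (below theta)) =>
     V theta k n z.1 z.2) = (fun z : rVm R d * g_sigma_algebraType (sources (below theta)) =>
     \sum_(p <- pairs n) weight k n p * sample theta k p z.1 z.2).
  by apply/funext => z; rewrite V_sum.
apply: bm_sum => p /mem_pairs[pn _]; apply: bmZ.
have bV : forall j theta i, (j < n)%N -> (i <= K)%N -> bounded_measurable
    (fun z : rVm R d * g_sigma_algebraType (sources (below theta)) =>
       V theta i j z.1 z.2) by move=> j t i jn iK; exact: ih.
have m1 : measurable_fun setT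
    (fst : rVm R d * g_sigma_algebraType (sources (below theta)) -> rVm R d) by [].
have m2 := measurableT_comp (sources_mono (@block_below theta p))
  (measurable_snd : measurable_fun setT
    (snd : rVm R d * g_sigma_algebraType (sources (below theta)) ->
       g_sigma_algebraType (sources (below theta)))).
exact: (bm_comp (measurable_fun_pair m1 m2) (sample_bm theta bV kK pn)).
Qed.

Lemma adapted_section (D : set Theta) (F : rVm R d * Omega -> R) (x : 'rV[R]_d) :
  bounded_measurable (F : rVm R d * g_sigma_algebraType (sources D) -> R) ->
  adapted D (fun w => F (x, w)).
Proof.
move=> bF; have m1 : measurable_fun [set: g_sigma_algebraType (sources D)]
  (fun=> x : rVm R d) by [].
have m2 : measurable_fun [set: g_sigma_algebraType (sources D)]
  (id : g_sigma_algebraType (sources D) -> g_sigma_algebraType (sources D)) by [].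
exact: (bm_comp (measurable_fun_pair m1 m2) bF).
Qed.

Lemma V_adapted n theta k x : (k <= K)%N -> adapted (below theta) (V theta k n x).
Proof.
move=> kK.
exact: (adapted_section (F := fun z => V theta k n z.1 z.2) x (V_bm n theta kK)).
Qed.

Lemma sample_adapted theta k p x : (k <= K)%N ->
  adapted (block theta p) (sample theta k p x).
Proof.
move=> kK; apply: (adapted_section (F := fun z => sample theta k p z.1 z.2) x).
by apply: (sample_bm (n := p.1.+1)) => // j t i _ iK; exact: V_bm.
Qed.

(** The identity is not a bounded test function, but its truncation at a common bound of [X] and [Y]
    is one and changes neither. *)
Lemma eqlaw_int X Y : bounded_measurable X -> bounded_measurable Y ->
  eqlaw P X Y -> \int[P]_w X w = \int[P]_w Y w.
Proof.
move=> [mX [B XB]] [mY [B' YB]] XY.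
pose b := Num.max B B'; pose phi (a : R) := Num.max (- b) (Num.min b a).
have phiE a : `|a| <= b -> phi a = a.
  by rewrite ler_norml => /andP[h1 h2]; rewrite /phi min_r // max_r.
have bphi : bounded_measurable phi.
  split; first by apply: measurable_maxr => //; exact: measurable_minr.
  exists `|b| => a; rewrite /phi.
  case: (leP b a) => [ba|ab].
    case: (leP (- b) b) => _ //; by rewrite normrN.
  case: (leP (- b) a) => [ba|ab'] ; last by rewrite normrN.
  by rewrite ler_norml; apply/andP; split;
    [rewrite (le_trans _ ba) // lerN2 ler_norm|rewrite (le_trans (ltW ab)) // ler_norm].
have := XY phi bphi.
under eq_Rintegral do rewrite phiE ?le_max ?XB //.
by under [X in _ = X -> _]eq_Rintegral do rewrite phiE ?le_max ?YB ?orbT //.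
Qed.

Section one_pair.
Variables (theta : Theta) (p : nat * nat).
Let D : set Theta :=
  below (append2 theta p.1%:Z p.2%:Z) `|` below (append2 theta p.1%:Z (- p.2%:Z)).

Lemma correction_bm_D i : (i <= K)%N -> bounded_measurable
  (fun z : rVm R d * g_sigma_algebraType (sources D) => correction theta p i z.1 z.2).
Proof.
by apply: (@correction_bm p.1.+1) => // j t l _ lK; exact: V_bm.
Qed.

(** The function [phi] is left open for three uses: test functions for laws, the identity for means,
    the square for second moments. *)
Lemma sample_int (p0 : p.1 != 0%N) k (phi : R -> R) x : (k <= K)%N ->
  (forall i, (i <= K)%N -> bounded_measurable
    (fun z : rVm R d * g_sigma_algebraType (sources D) =>
       phi (correction theta p i z.1 z.2))) ->
  k%:R * \int[P]_w phi (sample theta k p x w) =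
  \sum_(i < k) heat (k - i) (fun y => \int[P]_w phi (correction theta p i y w)) x.
Proof.
move=> kK bphi.
have nD : ~ D (append2 theta p.1%:Z p.2%:Z) by case; exact: not_below_append2.
have := randomized_int (G := fun i y w => phi (correction theta p i y w)) kK bphi x nD.
by rewrite /sample (negbTE p0).
Qed.

End one_pair.

Lemma sample0_law theta k m (psi : R -> R) x : (k <= K)%N ->
  bounded_measurable (psi \o (fun y : rVm R d => v 0%N y + grid k * f 0)) ->
  \int[P]_w psi (sample theta k (0%N, m) x w) =
  heat k (fun y => psi (v 0%N y + grid k * f 0)) x.
Proof. by move=> kK b; rewrite -(W_grid_law (append2 theta 0 (- m%:Z)) x kK b). Qed.

(** Induction on the level: distinct samples use disjoint sources, so it suffices to compare them
    one by one; at a frozen level and point, a sample is a difference of two independent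
    approximations of lower level. *)
Lemma V_law n k theta theta' x : (k <= K)%N ->
  eqlaw P (V theta k n x) (V theta' k n x).
Proof.
elim/ltn_ind: n k theta theta' x => n ih k theta theta' x kK.
have E t : V t k n x = fun w => \sum_(q <- pairs n) weight k n q * sample t k q x w.
  by apply/funext => w; rewrite V_sum.
rewrite !E; apply: (eqlaw_sum (D := block theta) (D' := block theta')).
- exact: uniq_pairs.
- by move=> q q' _ _ qq' t; exact: block_disjoint.
- by move=> q q' _ _ qq' t; exact: block_disjoint.
- by move=> q _; apply: bmZ; exact: sample_adapted.
- by move=> q _; apply: bmZ; exact: sample_adapted.
move=> [j m] /mem_pairs /= [jn m0].
have scale (a : R) : measurable_fun setT (fun b : R => a * b) by exact: measurable_funM.
have [j0|j0] := eqVneq j 0%N.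
  rewrite j0; apply: (eqlaw_comp (X := sample theta k (0%N, m) x)
    (Y := sample theta' k (0%N, m) x) (scale (weight k n (0%N, m)))) => phi bphi.
  have b1 : bounded_measurable (phi \o (fun y : rVm R d => v 0%N y + grid k * f 0)).
    apply: bm_comp bphi; apply: measurable_funD => //.
    by have [] := bm_v (leq0n K).
  by rewrite !sample0_law.
(* [sample_int] carries a factor k and says nothing for [k = 0]; there the weight [grid 0]
   vanishes. *)
have [k0|k0] := posnP k.
  move=> phi _; rewrite k0 /weight /= (negbTE j0) grid0.
  by apply: eq_Rintegral => w _; rewrite !mul0r.
apply: (eqlaw_comp (X := sample theta k (j, m) x)
  (Y := sample theta' k (j, m) x) (scale (weight k n (j, m)))) => phi bphi.
have kn0 : k%:R != 0 :> R by rewrite pnatr_eq0 -lt0n.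
apply: (mulfI kn0).
have bphi' t i : (i <= K)%N -> bounded_measurable
    (fun z : rVm R d * g_sigma_algebraType (sources
       (below (append2 t j%:Z m%:Z) `|` below (append2 t j%:Z (- m%:Z)))) =>
       phi (correction t (j, m) i z.1 z.2)).
  by move=> iK; have [mc _] := correction_bm_D t (j, m) iK; exact: (bm_comp mc bphi).
rewrite (sample_int (p := (j, m)) j0 x kK (bphi' theta)).
rewrite (sample_int (p := (j, m)) j0 x kK (bphi' theta')).
apply: eq_bigr => i _; rewrite /heat; apply: eq_Rintegral => w _.
have iK : (i <= K)%N by rewrite (leq_trans (ltnW (ltn_ord i))).
set y := (x + _).
(* Samples are numbered from 1, so the indices ending in m and in -m differ and their subtrees are
   disjoint. *)
have mm : m%:Z != - m%:Z by rewrite -subr_eq0 opprK -PoszD addnn eqz_nat double_eq0 -lt0n.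
have jn' : (j.-1 < n)%N by rewrite (leq_ltn_trans (leq_pred _)).
rewrite /correction /=.
apply: (eqlawD (X := f \o V (append2 theta j%:Z m%:Z) i j y)
               (Y := (fun a => - f a) \o V (append2 theta j%:Z (- m%:Z)) i j.-1 y)
               (X' := f \o V (append2 theta' j%:Z m%:Z) i j y)
               (Y' := (fun a => - f a) \o V (append2 theta' j%:Z (- m%:Z)) i j.-1 y)) => //.
- exact: (adapted_indep_rv (fun t => @below_append2_disjoint theta j%:Z _ _ t mm)
    (bm_f (V_adapted _ _ _ iK)) (bmN (bm_f (V_adapted _ _ _ iK)))).
- exact: (adapted_indep_rv (fun t => @below_append2_disjoint theta' j%:Z _ _ t mm)
    (bm_f (V_adapted _ _ _ iK)) (bmN (bm_f (V_adapted _ _ _ iK)))).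
- by apply: eqlaw_comp; [exact: f_measurable|exact: ih].
- apply: eqlaw_comp; last exact: ih.
  exact: measurable_funN f_measurable.
Qed.

Definition mean_f n i (y : 'rV[R]_d) : R := \int[P]_w f (V theta0 i n y w).

Lemma mean_fE n i theta y : (i <= K)%N -> \int[P]_w f (V theta i n y w) = mean_f n i y.
Proof.
move=> iK; apply: eqlaw_int.
- by apply: bm_f; exact: adapted_bm (V_adapted _ _ _ iK).
- by apply: bm_f; exact: adapted_bm (V_adapted _ _ _ iK).
- by apply: eqlaw_comp; [exact: f_measurable|exact: V_law].
Qed.

Lemma bm_V n theta k : (k <= K)%N ->
  bounded_measurable (fun z : rVm R d * Omega => V theta k n z.1 z.2).
Proof.
move=> kK; have m1 : measurable_fun [set: rVm R d * Omega]
  (fst : rVm R d * Omega -> rVm R d) by [].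
have m2 := measurableT_comp (g_sigma_id_measurable (sources_sub (D := below theta)))
  (measurable_snd : measurable_fun setT (snd : rVm R d * Omega -> Omega)).
exact: (bm_comp (measurable_fun_pair m1 m2) (V_bm n theta kK)).
Qed.

Lemma bm_mean_f n i : (i <= K)%N -> bounded_measurable (mean_f n i : rVm R d -> R).
Proof.
move=> iK; apply: (bm_fubini_F (T1 := rVm R d) P (F := fun z => f (V theta0 i n z.1 z.2))).
by apply: bm_f; exact: bm_V.
Qed.

Lemma V_mean n k theta x : (k <= K)%N ->
  \int[P]_w V theta k n.+1 x w - v k x =
  h * \sum_(i < k) heat (k - i) (fun y => mean_f n i y - f (v i y)) x.
Proof.
move=> kK; pose U j := \sum_(i < k) heat (k - i) (mean_f j i) x.
have kiK i : (k - i <= K)%N by rewrite (leq_trans (leq_subr _ _)).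
have iK (i : 'I_k) : (i <= K)%N by rewrite (leq_trans (ltnW (ltn_ord i))).
(* The telescoping sum leaves [U n - U 0]. As the approximation of level 0 is zero, [U 0] is k f(0),
   and h [U 0] cancels the summand [grid k * f 0] added to each terminal sample. *)
have U0 : U 0%N = k%:R * f 0.
  rewrite /U (eq_bigr (fun=> f 0)) ?sumr_const ?card_ord ?mulr_natl // => i _.
  rewrite (_ : mean_f 0 i = fun=> f 0) ?heat_cst //.
  apply/funext => y; rewrite /mean_f -[RHS](bm_int_cst P); apply: eq_Rintegral => w _.
  by rewrite V0.
have Mn0 j : M%:R ^+ j != 0 :> R by rewrite expf_neq0 // pnatr_eq0 -lt0n.
have sumM j (a : R) : \sum_(1 <= m < (M ^ j).+1) (a / M%:R ^+ j) = a.
  by rewrite sumr_const_nat subn1 /= -[LHS]mulr_natr natrX divfK.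
have mean0 m : \int[P]_w sample theta k (0%N, m) x w = heat k (v 0%N) x + grid k * f 0.
  have bv0 := bm_v (leq0n K).
  have bc : bounded_measurable (fun _ : rVm R d => grid k * f 0) by exact: bm_cst.
  rewrite (@sample0_law theta k m id x kK (bmD bv0 bc)) heatD //.
  by rewrite heat_cst.
have meanj j m : (0 < j)%N ->
    grid k * \int[P]_w sample theta k (j, m) x w = h * (U j - U j.-1).
  move=> j0; rewrite gridE [k%:R * h]mulrC -mulrA; congr (h * _).
  rewrite (@sample_int theta (j, m) _ k id x kK); first last.
  - by move=> i iK'; exact: correction_bm_D.
  - by rewrite /= -lt0n.
  rewrite /U -sumrB; apply: eq_bigr => i _.
  rewrite -heatB //; [|exact: bm_mean_f|exact: bm_mean_f].
  congr (heat _ _ x); apply/funext => y; rewrite /correction /= bm_intB.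
  - by rewrite !mean_fE.
  - by apply: bm_f; exact: adapted_bm (V_adapted _ _ _ (iK i)).
  - by apply: bm_f; exact: adapted_bm (V_adapted _ _ _ (iK i)).
have -> : \int[P]_w V theta k n.+1 x w =
    heat k (v 0%N) x + grid k * f 0 + h * (U n - U 0%N).
  rewrite (_ : (fun w => _) = fun w =>
      \sum_(q <- pairs n.+1) weight k n.+1 q * sample theta k q x w); last first.
    by apply/funext => w; rewrite V_sum.
  have bs q := adapted_bm (sample_adapted theta q x kK).
  rewrite bm_int_sum => [|q _]; last exact: bmZ.
  under eq_bigr do rewrite bm_intZ //.
  rewrite big_pairs big_ltn // subn0; congr (_ + _).
    rewrite -[RHS](sumM n.+1); apply: eq_bigr => m _.
    by rewrite mean0 /weight /= mulrC.
  rewrite big_add1 /= -telescope_sumr // mulr_sumr; apply: eq_big_nat => j jn.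
  rewrite -[RHS](sumM (n.+1 - j.+1)%N); apply: eq_bigr => m _.
  by rewrite /weight /= mulrAC meanj.
rewrite v_repr // U0 gridE.
have -> : \sum_(i < k) heat (k - i) (fun y => mean_f n i y - f (v i y)) x =
    U n - \sum_(i < k) heat (k - i) (fun y => f (v i y)) x.
  rewrite /U -sumrB; apply: eq_bigr => i _; rewrite -heatB //.
    exact: bm_mean_f.
  by apply: bm_f; exact: bm_v.
ring.
Qed.

Lemma sqr_sum_le (k : nat) (b : nat -> R) :
  (\sum_(i < k) b i) ^+ 2 <= k%:R * \sum_(i < k) b i ^+ 2.
Proof.
elim: k => [|k ih]; first by rewrite !big_ord0 expr0n mulr0.
rewrite !big_ord_recr /=; set S := \sum_(i < k) b i; set Q := \sum_(i < k) b i ^+ 2.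
have cross : 2 * (S * b k) <= Q + k%:R * b k ^+ 2.
  rewrite /S mulr_suml mulr_sumr.
  have -> : k%:R * b k ^+ 2 = \sum_(i < k) b k ^+ 2.
    by rewrite sumr_const card_ord mulr_natl.
  rewrite /Q -big_split /=; apply: ler_sum => i _.
  have := sqr_ge0 (b i - b k); nra.
have := ih; rewrite -/S -/Q -natr1 => ihS.
rewrite sqrrD mulrDr mulrDl mul1r -mulr_natl; nra.
Qed.

(** * Mean square error *)

(** For q = 1 + a one has a (1 + q + ... + q^n) = q^(n+1) - 1. In the induction step the variance
    takes 4 T L^2 of a and the bias T L^2, so a = 8 T L^2 leaves room. *)
Definition growth : R := 1 + 8 * T * L ^+ 2.
(** The square of the bound in [v_bound]: it controls the error at level 0, where the approximation
    is zero, and also the second moment of a terminal sample. *)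
Definition amplitude : R := (expR (L * T) * (L + T * `|f 0|)) ^+ 2.
Definition rate n : R := amplitude * growth ^+ n / M%:R ^+ n.
Definition time_weight k : R := (1 + M%:R * h) ^+ k.

Lemma M_gt0R : 0 < M%:R :> R. Proof. by rewrite ltr0n. Qed.

Lemma growth_ge1 : 1 <= growth.
Proof. by rewrite lerDl !mulr_ge0 ?sqr_ge0 // ltW. Qed.

Lemma amplitude_ge0 : 0 <= amplitude. Proof. exact: sqr_ge0. Qed.

Lemma rate_ge0 n : 0 <= rate n.
Proof.
have q0 : 0 <= growth by exact: le_trans growth_ge1.
exact: divr_ge0 (mulr_ge0 amplitude_ge0 (exprn_ge0 _ q0)) (exprn_ge0 _ (ler0n _ _)).
Qed.

Lemma time_weight_ge1 k : 1 <= time_weight k.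
Proof. by rewrite exprn_ege1 // lerDl mulr_ge0 // ltW // h_gt0. Qed.

(* This gain of a factor [1 / M] replaces a discrete Gronwall inequality. *)
Lemma sum_time_weight k : h * \sum_(i < k) time_weight i <= time_weight k / M%:R.
Proof.
rewrite ler_pdivlMr ?M_gt0R //.
have -> : h * (\sum_(i < k) time_weight i) * M%:R = time_weight k - 1.
  by rewrite /time_weight subrX1 [1 + _]addrC addrK mulrAC [h * _]mulrC.
by rewrite gerBl.
Qed.

Definition sq_error n theta k x : R := \int[P]_w (V theta k n x w - v k x) ^+ 2.

Lemma bm_Vx n theta k x : (k <= K)%N -> bounded_measurable (V theta k n x).
Proof. by move=> kK; exact: adapted_bm (V_adapted n theta x kK). Qed.

(** Jensen's inequality and the Lipschitz bound control each time step, Cauchy-Schwarz costs a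
    factor k, and h^2 k is split as (k h) h: the first part is at most T, the second goes with the
    sum of time weights. *)
Lemma bias_le n k theta x :
  (forall i t y, (i <= K)%N -> sq_error n t i y <= rate n * time_weight i) ->
  (k <= K)%N ->
  (\int[P]_w V theta k n.+1 x w - v k x) ^+ 2 <=
    T * L ^+ 2 * rate n * time_weight k / M%:R.
Proof.
move=> err kK; rewrite V_mean // exprMn.
have kiK i : (k - i <= K)%N by rewrite (leq_trans (leq_subr _ _)).
have iK (i : 'I_k) : (i <= K)%N by rewrite (leq_trans (ltnW (ltn_ord i))).
set b := fun i => heat (k - i) (fun y => mean_f n i y - f (v i y)) x.
have bi (i : 'I_k) : b i ^+ 2 <= L ^+ 2 * (rate n * time_weight i).
  have bm1 : bounded_measurable ((fun y => mean_f n i y - f (v i y)) : rVm R d -> R).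
    by apply: bmB; [exact: bm_mean_f|apply: bm_f; exact: bm_v].
  apply: (le_trans (heat_sqr x (kiK i) bm1)).
  apply: heat_le_cst => //; first exact: bmX.
  move=> y; have bV := bm_Vx n theta0 y (iK i).
  rewrite /mean_f -[X in _ - X](bm_int_cst P) -bm_intB; [|exact: bm_f|exact: bm_cst].
  have b1 : bounded_measurable (fun w => f (V theta0 i n y w) - f (v i y)).
    by apply: bmB; [exact: bm_f|exact: bm_cst].
  have b2 : bounded_measurable (fun w => (V theta0 i n y w - v i y) ^+ 2).
    by apply: bmX; apply: bmB => //; exact: bm_cst.
  apply: (le_trans (bm_sqr_int P b1)).
  apply: (@le_trans _ _ (\int[P]_w (L ^+ 2 * (V theta0 i n y w - v i y) ^+ 2))).
    by apply: bm_int_le; [exact: bmX|exact: bmZ|move=> w; exact: f_lip_sqr].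
  by rewrite bm_intZ // ler_wpM2l ?sqr_ge0 //; exact: err.
have kh : k%:R * h <= T by have /andP[_] := grid_itv kK; rewrite gridE.
apply: (@le_trans _ _ (h ^+ 2 * (k%:R * \sum_(i < k) L ^+ 2 * (rate n * time_weight i)))).
  rewrite ler_wpM2l ?sqr_ge0 //; apply: (le_trans (sqr_sum_le k b)).
  by rewrite ler_wpM2l //; apply: ler_sum => i _; exact: bi.
rewrite -mulr_sumr -mulr_sumr.
have -> : h ^+ 2 * (k%:R * (L ^+ 2 * (rate n * \sum_(i < k) time_weight i))) =
  (k%:R * h) * (L ^+ 2 * rate n) * (h * \sum_(i < k) time_weight i) by ring.
have -> : T * L ^+ 2 * rate n * time_weight k / M%:R =
  T * (L ^+ 2 * rate n) * (time_weight k / M%:R) by rewrite !mulrA.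
have Lr : 0 <= L ^+ 2 * rate n by rewrite mulr_ge0 ?sqr_ge0 ?rate_ge0.
have h0 := ltW h_gt0.
apply: ler_pM => //.
- by rewrite mulr_ge0 // mulr_ge0.
- rewrite mulr_ge0 // sumr_ge0 // => i _; exact: le_trans (time_weight_ge1 _).
- by rewrite ler_wpM2r.
- exact: sum_time_weight.
Qed.

(** Both approximations are compared with the same exact value [v i y]; the factor 2 is from (a -
    b)^2 <= 2 (a^2 + b^2). *)
Lemma correction_sqr_le theta p i y : (i <= K)%N ->
  (forall t, sq_error p.1 t i y <= rate p.1 * time_weight i) ->
  (forall t, sq_error p.1.-1 t i y <= rate p.1.-1 * time_weight i) ->
  \int[P]_w correction theta p i y w ^+ 2 <=
    2 * L ^+ 2 * (rate p.1 + rate p.1.-1) * time_weight i.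
Proof.
move=> iK err1 err2.
set t1 := append2 theta p.1%:Z p.2%:Z; set t2 := append2 theta p.1%:Z (- p.2%:Z).
have bV n t := bm_Vx n t y iK.
have bVv n t : bounded_measurable (fun w => (V t i n y w - v i y) ^+ 2).
  by apply: bmX; apply: bmB; [exact: bV|exact: bm_cst].
apply: (@le_trans _ _ (\int[P]_w (2 * L ^+ 2 *
   ((V t1 i p.1 y w - v i y) ^+ 2 + (V t2 i p.1.-1 y w - v i y) ^+ 2)))).
  apply: bm_int_le.
  - by apply: bmX; apply: bmB; apply: bm_f; exact: bV.
  - by apply: bmZ; apply: bmD.
  move=> w; apply: (le_trans (f_lip_sqr _ _)).
  rewrite -/t1 -/t2 (_ : 2 * L ^+ 2 * _ = L ^+ 2 * (2 * ((V t1 i p.1 y w - v i y) ^+ 2 +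
    (V t2 i p.1.-1 y w - v i y) ^+ 2))); last by ring.
  rewrite ler_wpM2l ?sqr_ge0 //.
  have := sqr_ge0 ((V t1 i p.1 y w - v i y) + (V t2 i p.1.-1 y w - v i y)); nra.
rewrite bm_intZ; last exact: bmD.
rewrite bm_intD // [leRHS](_ : _ = 2 * L ^+ 2 *
  (rate p.1 * time_weight i + rate p.1.-1 * time_weight i)); last by ring.
have L2 : 0 <= 2 * L ^+ 2 by rewrite mulr_ge0 ?sqr_ge0.
rewrite ler_wpM2l //.
by apply: lerD; [exact: err1|exact: err2].
Qed.

Lemma sample0_sqr_le theta k m x : (k <= K)%N ->
  \int[P]_w sample theta k (0%N, m) x w ^+ 2 <= (L + T * `|f 0|) ^+ 2.
Proof.
move=> kK; rewrite -[leRHS](bm_int_cst P); apply: bm_int_le.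
- by apply: bmX; exact: adapted_bm (sample_adapted theta (0%N, m) x kK).
- exact: bm_cst.
move=> w; rewrite /sample /= -real_normK ?num_real // lerXn2r ?nnegrE //.
  by rewrite addr_ge0 ?(ltW L_gt0) // mulr_ge0 // ltW.
rewrite (le_trans (ler_normD _ _)) // lerD //.
have /andP[g0 gT] := grid_itv kK.
by rewrite normrM (ger0_norm g0) ler_wpM2r.
Qed.

Lemma sample_sqr_le theta k j m x : (k <= K)%N -> (0 < j)%N ->
  (forall i t y, (i <= K)%N -> sq_error j t i y <= rate j * time_weight i) ->
  (forall i t y, (i <= K)%N -> sq_error j.-1 t i y <= rate j.-1 * time_weight i) ->
  grid k ^+ 2 * \int[P]_w sample theta k (j, m) x w ^+ 2 <=
    2 * T * L ^+ 2 * (rate j + rate j.-1) * (time_weight k / M%:R).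
Proof.
move=> kK j0 err1 err2.
have kiK i : (k - i <= K)%N by rewrite (leq_trans (leq_subr _ _)).
have iK (i : 'I_k) : (i <= K)%N by rewrite (leq_trans (ltnW (ltn_ord i))).
have jn0 : (j, m).1 != 0%N by rewrite /= -lt0n.
have bcor i : (i <= K)%N -> bounded_measurable (fun z : rVm R d * g_sigma_algebraType
    (sources (below (append2 theta j%:Z m%:Z) `|` below (append2 theta j%:Z (- m%:Z)))) =>
    (correction theta (j, m) i z.1 z.2) ^+ 2).
  by move=> iK'; exact: (bmX 2 (correction_bm_D theta (j, m) iK')).
have E := @sample_int theta (j, m) jn0 k (fun a => a ^+ 2) x kK bcor.
(* Of the squared prefactor (k h)^2, one factor k h is bounded by T, one k is consumed by the random
   level, and the remaining h multiplies the time sum. *)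
have -> : grid k ^+ 2 * \int[P]_w sample theta k (j, m) x w ^+ 2 =
    (k%:R * h) * (h * (k%:R * \int[P]_w sample theta k (j, m) x w ^+ 2)).
  by rewrite gridE; ring.
rewrite E; set c := 2 * L ^+ 2 * (rate j + rate j.-1).
have c0 : 0 <= c.
  by rewrite /c mulr_ge0 ?addr_ge0 ?rate_ge0 // mulr_ge0 ?sqr_ge0.
have kh : k%:R * h <= T by have /andP[_] := grid_itv kK; rewrite gridE.
have h0 := ltW h_gt0.
have -> : 2 * T * L ^+ 2 * (rate j + rate j.-1) * (time_weight k / M%:R) =
    T * (c * (time_weight k / M%:R)) by rewrite /c; ring.
have tw i : 0 <= time_weight i by exact: le_trans (time_weight_ge1 _).
apply: (@le_trans _ _ (k%:R * h * (c * (h * \sum_(i < k) time_weight i)))).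
  apply: ler_wpM2l; first by rewrite mulr_ge0.
  rewrite [leRHS]mulrCA; apply: ler_wpM2l => //; rewrite mulr_sumr.
  apply: ler_sum => i _; apply: heat_le_cst => //.
    exact: (bm_frozen (bcor i (iK i))).
  by move=> y; apply: correction_sqr_le => // t; [exact: err1|exact: err2].
apply: ler_pM => //.
- by rewrite mulr_ge0.
- by rewrite mulr_ge0 // mulr_ge0 // sumr_ge0.
- by rewrite ler_wpM2l // sum_time_weight.
Qed.

Lemma amplitude_ge : (L + T * `|f 0|) ^+ 2 <= amplitude.
Proof.
have LT0 : 0 <= L + T * `|f 0| by rewrite addr_ge0 ?(ltW L_gt0) // mulr_ge0 // ltW.
rewrite /amplitude exprMn ler_peMl ?sqr_ge0 // exprn_ege1 //.
by rewrite -expR0 ler_expR mulr_ge0 // ltW.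
Qed.

(** Variances add over the independent samples, and each is at most a second moment. M^i samples
    with squared weight of order M^(-2 i) contribute M^(-i). *)
Lemma variance_le n k theta x :
  (forall j, (j < n.+1)%N -> forall i t y, (i <= K)%N ->
     sq_error j t i y <= rate j * time_weight i) ->
  (k <= K)%N ->
  \int[P]_w (V theta k n.+1 x w - \int[P]_w' V theta k n.+1 x w') ^+ 2 <=
    amplitude / M%:R ^+ n.+1 + \sum_(1 <= j < n.+1)
      2 * T * L ^+ 2 * (rate j + rate j.-1) * (time_weight k / M%:R) / M%:R ^+ (n.+1 - j).
Proof.
move=> err kK.
have E : V theta k n.+1 x = fun w =>
    \sum_(q <- pairs n.+1) weight k n.+1 q * sample theta k q x w.
  by apply/funext => w; rewrite V_sum.
have bs q := adapted_bm (sample_adapted theta q x kK).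
have Mn0 j : M%:R ^+ j != 0 :> R by rewrite expf_neq0 // pnatr_eq0 -lt0n.
have sumM j (a : R) : \sum_(1 <= m < (M ^ j).+1) (a / M%:R ^+ j ^+ 2) = a / M%:R ^+ j.
  rewrite sumr_const_nat subn1 /= -[LHS]mulr_natr natrX.
  by rewrite expr2 invfM mulrA divfK.
rewrite E (@variance_sum _ _ (block theta) (fun q w => weight k n.+1 q * sample theta k q x w));
  first last.
- by move=> q _; apply: bmZ; exact: sample_adapted.
- by move=> q q' _ _ qq' t; exact: block_disjoint.
- exact: uniq_pairs.
apply: (@le_trans _ _ (\sum_(q <- pairs n.+1)
    weight k n.+1 q ^+ 2 * \int[P]_w sample theta k q x w ^+ 2)).
  apply: ler_sum => q _.
  apply: (le_trans (bm_variance_le P (bmZ (weight k n.+1 q) (bs q)) 0)).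
  rewrite -bm_intZ; last exact: bmX.
  by under eq_Rintegral do rewrite subr0 exprMn.
rewrite big_pairs big_ltn // subn0; apply: lerD.
  rewrite -sumM; apply: ler_sum => m _; rewrite /weight /= exprVn mulrC.
  rewrite ler_wpM2r ?invr_ge0 ?sqr_ge0 //.
  by rewrite (le_trans (sample0_sqr_le _ _ _ kK)) // amplitude_ge.
rewrite [leLHS]big_nat [leRHS]big_nat; apply: ler_sum => j /andP[j0 jn].
rewrite -sumM; apply: ler_sum => m _; rewrite /weight /= gtn_eqF // exprMn exprVn mulrAC.
rewrite ler_wpM2r ?invr_ge0 ?sqr_ge0 //; apply: sample_sqr_le => //.
  exact: err.
by apply: err; rewrite (leq_ltn_trans (leq_pred _)).
Qed.

Theorem sq_error_le n k theta x : (k <= K)%N ->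
  sq_error n theta k x <= rate n * time_weight k.
Proof.
elim/ltn_ind: n k theta x => -[_|n ih] k theta x kK.
  rewrite /sq_error /rate expr0 divr1 mulr1.
  have v2 : v k x ^+ 2 <= amplitude.
    rewrite -real_normK ?num_real // lerXn2r ?nnegrE //; last exact: v_bound.
    by rewrite mulr_ge0 ?expR_ge0 // addr_ge0 ?(ltW L_gt0) // mulr_ge0 // ltW.
  under eq_Rintegral do rewrite V0 // sub0r sqrrN.
  rewrite bm_int_cst (le_trans v2) // ler_peMr ?amplitude_ge0 //.
  exact: time_weight_ge1.
rewrite /sq_error (bm_variance P (bm_Vx n.+1 theta x kK)).
apply: (le_trans (lerD (variance_le theta x _ kK) (bias_le theta x _ kK))).
- by move=> j jn i t y iK; exact: ih.
- by move=> i t y iK; exact: ih.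
have g1 := time_weight_ge1 k; set g := time_weight k in g1 *.
have g0 : 0 <= g by exact: le_trans g1.
have q1 := growth_ge1; have A0 := amplitude_ge0.
have TL : 0 <= T * L ^+ 2 by rewrite mulr_ge0 ?sqr_ge0 // ltW.
have TA : 0 <= T * L ^+ 2 * amplitude by exact: mulr_ge0 TL A0.
have TA4 : 0 <= 4 * (T * L ^+ 2) * amplitude.
  by rewrite -mulrA; exact: mulr_ge0 TA.
have M0 := M_gt0R; have M1 : 1 <= M%:R :> R by rewrite ler1n.
have Mi0 j : 0 < M%:R ^+ j :> R by rewrite exprn_gt0.
have gM : 0 <= g / M%:R ^+ n.+1 by exact: divr_ge0 g0 (ltW (Mi0 _)).
pose S := \sum_(i < n.+1) growth ^+ i.
have q0 j : 0 <= growth ^+ j by rewrite exprn_ge0 // (le_trans _ q1).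
have S1 : 8 * (T * L ^+ 2) * S = growth ^+ n.+1 - 1.
  by rewrite subrX1 /S /growth [1 + _]addrC addrK mulrA.
(* The gained 1 / M turns [rate j.-1] into at most [rate j], and is simply given away on [rate j];
   the powers M^(-j) and M^(j - n - 1) then combine to M^(-(n + 1)). *)
have step j : (0 < j < n.+1)%N ->
    2 * T * L ^+ 2 * (rate j + rate j.-1) * (g / M%:R) / M%:R ^+ (n.+1 - j) <=
    g / M%:R ^+ n.+1 * (4 * (T * L ^+ 2) * amplitude * growth ^+ j).
  move=> /andP[j0 jn].
  have rj : rate j / M%:R <= rate j by rewrite ler_pdivrMr // ler_peMr // rate_ge0.
  have rj1 : rate j.-1 / M%:R <= rate j.
    move: j0; case: (j) => // i _; rewrite /rate /= -mulrA -invfM -exprSr.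
    by rewrite ler_pM2r ?invr_gt0 // ler_wpM2l // exprS ler_peMl.
  have -> : 2 * T * L ^+ 2 * (rate j + rate j.-1) * (g / M%:R) / M%:R ^+ (n.+1 - j) =
    2 * (T * L ^+ 2) * g / M%:R ^+ (n.+1 - j) * (rate j / M%:R + rate j.-1 / M%:R).
    by ring.
  apply: (le_trans (ler_wpM2l _ (lerD rj rj1))).
    by apply: divr_ge0 (ltW (Mi0 _)); apply: mulr_ge0 => //; apply: mulr_ge0.
  rewrite /rate -[in leRHS](subnK (ltnW jn)) exprD invfM.
  by rewrite le_eqVlt; apply/orP; left; apply/eqP; ring.
have sumle : \sum_(1 <= j < n.+1)
    2 * T * L ^+ 2 * (rate j + rate j.-1) * (g / M%:R) / M%:R ^+ (n.+1 - j) <=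
    g / M%:R ^+ n.+1 * (4 * (T * L ^+ 2) * amplitude * S).
  apply: (@le_trans _ _ (\sum_(1 <= j < n.+1)
      g / M%:R ^+ n.+1 * (4 * (T * L ^+ 2) * amplitude * growth ^+ j))).
    rewrite [leLHS]big_nat [leRHS]big_nat; apply: ler_sum => j; exact: step.
  rewrite -!mulr_sumr; apply: (ler_wpM2l gM); apply: (ler_wpM2l TA4).
  rewrite /S -(big_mkord xpredT (fun i => growth ^+ i)) [leRHS]big_ltn //.
  by rewrite lerDr.
have biasle : T * L ^+ 2 * rate n * g / M%:R <=
    g / M%:R ^+ n.+1 * ((T * L ^+ 2) * amplitude * S).
  have -> : T * L ^+ 2 * rate n * g / M%:R =
     g / M%:R ^+ n.+1 * (T * L ^+ 2 * amplitude * growth ^+ n).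
    by rewrite /rate [M%:R ^+ n.+1]exprSr invfM; ring.
  apply: (ler_wpM2l gM); apply: (ler_wpM2l TA).
  by rewrite /S big_ord_recr /= lerDr sumr_ge0.
have ale : amplitude / M%:R ^+ n.+1 <= g / M%:R ^+ n.+1 * amplitude.
  rewrite [leRHS](_ : _ = g * amplitude / M%:R ^+ n.+1); last by ring.
  by apply: ler_wpM2r; [rewrite invr_ge0 (ltW (Mi0 _))|rewrite ler_peMl].
have -> : rate n.+1 * g = g / M%:R ^+ n.+1 * (amplitude * growth ^+ n.+1).
  by rewrite /rate; ring.
apply: (le_trans (lerD (lerD ale sumle) biasle)).
rewrite -!mulrDr; apply: (ler_wpM2l gM).
have S0 : 0 <= S by rewrite sumr_ge0.
have TAS : 0 <= T * L ^+ 2 * amplitude * S by exact: mulr_ge0 TA S0.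
(* The summand 1 pays for the terminal samples; of the multiple 8, corrections use 4 and the bias
   1. *)
have : amplitude * growth ^+ n.+1 = amplitude + 8 * (T * L ^+ 2 * amplitude * S).
  have -> : growth ^+ n.+1 = 1 + 8 * (T * L ^+ 2) * S by rewrite S1; ring.
  by ring.
move=> ->; lra.
Qed.

End randomness.

(** * Computational cost *)

(** The base 5 is 1 + 4: each bracket is at most 4 d (5 M)^j, namely 2 for d + 1 and 1 for each of
    the two costs, and 4 (5 + ... + 5^n) = 5^(n+1) - 5. *)
Lemma cost_le (C : nat -> nat) (d M : nat) : (0 < d)%N ->
  (C 0%N <= d)%N ->
  (forall n, (1 <= n)%N -> (C n <= d * M ^ n +
     \sum_(1 <= j < n) M ^ (n - j) * (d + 1 + C j + C j.-1))%N) ->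
  (0 < M)%N -> forall n, (C n <= d * (5 * M) ^ n)%N.
Proof.
move=> d0 C0 Crec M0; elim/ltn_ind => -[_|n ih]; first by rewrite expn0 muln1.
have step j : (0 < j < n.+1)%N ->
    (M ^ (n.+1 - j) * (d + 1 + C j + C j.-1) <= d * M ^ n.+1 * (4 * 5 ^ j))%N.
  move=> /andP[j0 jn].
  have h1 : (C j <= d * (5 * M) ^ j)%N by exact: ih.
  have h2 : (C j.-1 <= d * (5 * M) ^ j)%N.
    apply: (leq_trans (ih _ _)); first by rewrite (leq_ltn_trans (leq_pred _)).
    by rewrite leq_mul2l leq_pexp2l ?leq_pred ?orbT // muln_gt0.
  have h3 : (d + 1 <= d * (2 * (5 * M) ^ j))%N.
    have : (0 < (5 * M) ^ j)%N by rewrite expn_gt0 muln_gt0 M0.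
    by move: ((5 * M) ^ j)%N => X X0; nia.
  have h4 : (d + 1 + C j + C j.-1 <= d * (4 * (5 * M) ^ j))%N.
    by move: ((5 * M) ^ j)%N h1 h2 h3 => X h1 h2 h3; nia.
  apply: (leq_trans (leq_mul (leqnn _) h4)).
  rewrite -{2}(subnK (ltnW jn)) expnD expnMn.
  by apply: eq_leq; lia.
apply: (leq_trans (Crec _ _)) => //.
apply: (@leq_trans (d * M ^ n.+1 + \sum_(1 <= j < n.+1) d * M ^ n.+1 * (4 * 5 ^ j))%N).
  rewrite leq_add2l big_nat_cond [leqRHS]big_nat_cond.
  by apply: leq_sum => j /andP[/step].
rewrite -big_distrr /= -{1}(muln1 (d * M ^ n.+1)%N) -mulnDr expnMn.
rewrite [(5 ^ _ * _)%N]mulnC mulnA leq_mul2l; apply/orP; right.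
have -> : (\sum_(1 <= j < n.+1) 4 * 5 ^ j = 5 ^ n.+1 - 5)%N.
  elim: (n) => [|k IH]; first by rewrite big_geq.
  rewrite big_nat_recr //= IH [in RHS]expnS.
  have : (5 <= 5 ^ k.+1)%N by rewrite -{1}(expn1 5) leq_pexp2l.
  by move: (5 ^ k.+1)%N => X; lia.
have : (5 <= 5 ^ n.+1)%N by rewrite -{1}(expn1 5) leq_pexp2l.
by move: (5 ^ n.+1)%N => X; lia.
Qed.

(** * Choice of the sample size *)

Section complexity.
Context (R : realType) (A b delta : R).
Hypotheses (A_ge0 : 0 <= A) (b_gt0 : 0 < b) (delta_gt0 : 0 < delta).

(* [e n] bounds the mean square error of the scheme with [M = n]. *)
Let e (n : nat) : R := A * (b / n%:R) ^+ n.
Let s : R := delta / 2.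
(** The cost at m + 1 is paired with the error at m, as the least admissible size is m + 1 when m
    fails. With s = delta / 2, eps^(2 + delta) is the power 1 + s of the squared accuracy. *)
Let F (m : nat) : R := (5 * m.+1%:R) ^+ m.+1 * e m `^ (1 + s).

Let e_ge0 n : 0 <= e n.
Proof. by rewrite /e mulr_ge0 // exprn_ge0 // divr_ge0 // ltW. Qed.

Let s_gt0 : 0 < s. Proof. by rewrite divr_gt0. Qed.

Lemma half_power_le (n : nat) : n%:R * (2^-1 : R) ^+ n <= 1.
Proof.
rewrite exprVn ler_pdivrMr ?exprn_gt0 // mul1r -natrX ler_nat.
exact: ltnW (ltn_expl _ _).
Qed.

Lemma error_small (eps : R) : 0 < eps -> exists n : nat, (0 < n)%N /\ e n <= eps.
Proof.
(* From n >= 2 b follows (b / n)^n <= 2^(-n) <= 1 / n, and then n >= A / eps suffices. *)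
move=> e0; pose n := (Num.truncn (2 * b) + Num.truncn (A / eps)).+1.
have n0 : 0 < n%:R :> R by rewrite ltr0n.
have nb : 2 * b <= n%:R.
  have := truncnS_gt (2 * b); move=> /ltW h; apply: (le_trans h).
  by rewrite ler_nat ltnS leq_addr.
have nA : A / eps <= n%:R.
  have := truncnS_gt (A / eps); move=> /ltW h; apply: (le_trans h).
  by rewrite ler_nat ltnS leq_addl.
exists n; split => //; rewrite /e.
have b2 : (b / n%:R) ^+ n <= 2^-1 ^+ n.
  rewrite lerXn2r ?nnegrE ?divr_ge0 // ?(ltW b_gt0) //.
  by rewrite ler_pdivrMr // mulrC ler_pdivlMr // mulrC.
apply: (le_trans (ler_wpM2l A_ge0 b2)).
have h := half_power_le n.
have h2 : 2^-1 ^+ n <= n%:R^-1 :> R by rewrite -[leRHS]mul1r ler_pdivlMr // mulrC.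
apply: (le_trans (ler_wpM2l A_ge0 h2)).
by rewrite ler_pdivrMr // mulrC -ler_pdivrMr.
Qed.

(** F m <= 10 A A^s m (10 b (b / m)^s)^m: the factors m^m of cost and error cancel, and the extra
    power s of the error drives the base below 1/2, after which m 2^(-m) <= 1. *)
Lemma cost_error_bounded : exists c : R, forall m, (0 < m)%N -> F m <= c.
Proof.
have [m0 hm0] : exists m0 : nat, forall m, (m0 <= m)%N -> (0 < m)%N ->
    10 * b * (b / m%:R) `^ s <= 2^-1.
  (* The solution of 10 b t^s = 1/2. *)
  pose t : R := (20 * b)^-1 `^ s^-1.
  have t0 : 0 < t by rewrite powR_gt0 // invr_gt0 mulr_gt0.
  exists (Num.truncn (b / t)).+1 => m mm m1.
  have m0 : 0 < m%:R :> R by rewrite ltr0n.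
  have bt : b / m%:R <= t.
    rewrite ler_pdivrMr // mulrC -ler_pdivrMr //.
    by apply: (le_trans (ltW (truncnS_gt _))); rewrite ler_nat.
  have h : (b / m%:R) `^ s <= (20 * b)^-1.
    have -> : (20 * b)^-1 = t `^ s.
      by rewrite /t -powRrM mulVf ?gt_eqF // powRr1 // invr_ge0 mulr_ge0 // ltW.
    by apply: ge0_ler_powR; rewrite ?nnegrE ?(ltW s_gt0) ?(ltW t0) // divr_ge0 // ltW.
  have b10 : 0 <= 10 * b by rewrite mulr_ge0 // ltW.
  apply: (le_trans (ler_wpM2l b10 h)).
  by rewrite ler_pdivrMr ?mulr_gt0 //; lra.
have F0 m : 0 <= F m by rewrite /F mulr_ge0 ?powR_ge0 // exprn_ge0 // mulr_ge0.
(* The finite sum covers the indices below [m0], where the base may be large. *)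
exists (10 * A * A `^ s + \sum_(m < m0) F m) => m m1.
have A0 : 0 <= 10 * A * A `^ s by rewrite !mulr_ge0 // powR_ge0.
have [mm|mm] := ltnP m m0.
  by rewrite (bigD1 (Ordinal mm)) //= addrCA lerDl addr_ge0 // sumr_ge0.
have mR : 0 < m%:R :> R by rewrite ltr0n.
have bm0 : 0 <= b / m%:R by rewrite divr_ge0 // ltW.
apply: (@le_trans _ _ (10 * A * A `^ s)); last by rewrite lerDl sumr_ge0.
have eE : e m `^ (1 + s) = A * (b / m%:R) ^+ m * (A `^ s * ((b / m%:R) `^ s) ^+ m).
  rewrite powRD; last by rewrite gt_eqF ?addr_gt0.
  rewrite (powRr1 (e_ge0 m)) /e (powRM _ A_ge0 (exprn_ge0 m bm0)); congr (_ * (_ * _)).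
  by rewrite -(powR_mulrn m bm0) powRAC powR_mulrn // powR_ge0.
have h5 : (5 * m.+1%:R) ^+ m.+1 <= (10 * m%:R) ^+ m.+1 :> R.
  rewrite lerXn2r ?nnegrE ?mulr_ge0 //.
  have : 1 <= m%:R :> R by rewrite ler1n.
  by rewrite -natr1; lra.
rewrite /F eE.
have X0 : 0 <= A * (b / m%:R) ^+ m * (A `^ s * ((b / m%:R) `^ s) ^+ m).
  by rewrite !mulr_ge0 ?exprn_ge0 ?powR_ge0.
apply: (le_trans (ler_wpM2r X0 h5)).
have -> : (10 * m%:R) ^+ m.+1 * (A * (b / m%:R) ^+ m * (A `^ s * ((b / m%:R) `^ s) ^+ m)) =
  10 * A * A `^ s * (m%:R * (10 * b * (b / m%:R) `^ s) ^+ m).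
  rewrite exprS !exprMn exprVn; field.
  by rewrite expf_neq0 // gt_eqF.
rewrite ler_piMr //.
apply: (le_trans _ (half_power_le m)).
rewrite ler_pM2l // lerXn2r ?nnegrE ?mulr_ge0 ?powR_ge0 ?(ltW b_gt0) //.
exact: hm0.
Qed.

Lemma sample_size : exists (N : R -> nat) (c : R), forall eps, 0 < eps <= 1 ->
  [/\ (0 < N eps)%N, e (N eps) <= eps ^+ 2 &
      (5 * (N eps)%:R) ^+ N eps <= c * eps `^ (- (2 + delta))].
Proof.
have [c hc] := cost_error_bounded.
suff H eps : 0 < eps <= 1 -> exists n : nat,
    [/\ (0 < n)%N, e n <= eps ^+ 2 &
      (5 * n%:R) ^+ n <= (5 + `|c|) * eps `^ (- (2 + delta))].
  have H' eps : exists n : nat, 0 < eps <= 1 -> [/\ (0 < n)%N, e n <= eps ^+ 2 &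
      (5 * n%:R) ^+ n <= (5 + `|c|) * eps `^ (- (2 + delta))].
    have [h|h] := boolP (0 < eps <= 1); last by exists 0%N.
    by have [n hn] := H _ h; exists n.
  have [N hN] := choice H'.
  by exists N, (5 + `|c|).
move=> /andP[e0 e1].
have [n0 [n00 en0]] := error_small (exprn_gt0 2 e0).
have ex : exists n, (0 < n)%N && (e n <= eps ^+ 2) by exists n0; rewrite n00.
(* The least [n] is wanted: then [e] still exceeds [eps ^+ 2] at [n - 1]. *)
case: (ex_minnP ex) => n /andP[n1 en] nmin; exists n; split => //.
have p0 : 0 < eps `^ (2 + delta) by exact: powR_gt0.
rewrite powRN ler_pdivlMr //.
have pE : eps `^ (2 + delta) = (eps ^+ 2) `^ (1 + s).
  rewrite -powR_mulrn ?(ltW e0) // -powRrM mulrDr mulr1 /s mulrCA mulfV ?mulr1 //.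
(* For n = 1 the predecessor 0 is ruled out by positivity, not by its error; the cost is then 5 and
   eps^(2 + delta) <= 1, whence the 5 in the constant. *)
case: n n1 en nmin => // -[_ _ _|m _ en nmin].
  rewrite mulr1 expr1.
  have : eps `^ (2 + delta) <= 1.
    have d2 : 0 <= 2 + delta by rewrite addr_ge0 // ltW.
    by have := ge0_ler_powR d2 (ltW e0) ler01 e1; rewrite powR1.
  have := normr_ge0 c; nra.
have em : eps ^+ 2 <= e m.+1.
  by rewrite leNgt; apply/negP => /ltW h; have := nmin m.+1; rewrite h /= ltnn => /(_ isT).
rewrite pE; apply: (@le_trans _ _ (F m.+1)).
  rewrite /F ler_wpM2l ?exprn_ge0 ?mulr_ge0 //.
  apply: ge0_ler_powR; rewrite ?nnegrE ?sqr_ge0 // addr_ge0 // ltW //.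
have := hc m.+1 isT => h; apply: (le_trans h); rewrite (le_trans (ler_norm _)) //.
by rewrite lerDr.
Qed.

End complexity.

(** Serves to restrict the family of Brownian motions indexed by pairs (d, theta) to a fixed
    dimension. *)
Lemma mutually_independent_inj (disp : measure_display) (Omega : measurableType disp)
    (R : realType) (P : probability Omega R) (I J : choiceType) (phi : I -> J)
    (D : set I) (E : set J) (G : J -> set_system Omega) :
  injective phi -> (forall i, D i -> E (phi i)) ->
  mutually_independent P E G -> mutually_independent P D (G \o phi).
Proof.
move=> phiI DE indG s us sD A GA.
have mphi i : phi i \in map phi s = (i \in s) by rewrite mem_map.
(* A left inverse of [phi] on the finite list only, by lookup; elsewhere it gives [None], and the
   event defaults to [setT]. *)
pose inv j := nth None (map Some s) (index j (map phi s)).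
have invK i : i \in s -> inv (phi i) = Some i.
  move=> si; rewrite /inv index_map // (nth_map i) ?index_mem // nth_index //.
pose B j := if inv j is Some i then A i else setT.
have BA i : i \in s -> B (phi i) = A i by move=> si; rewrite /B invK.
have := indG (map phi s) _ _ B _; rewrite big_map.
have -> : \bigcap_(j in [set` map phi s]) B j = \bigcap_(i in [set` s]) A i.
  apply/seteqP; split=> [w h i /= si|w h j /= /mapP[i si ->]].
    by rewrite -BA //; apply: h; rewrite /= mphi.
  by rewrite BA //; exact: h.
move=> ->.
- by rewrite big_seq [in RHS]big_seq; apply: eq_bigr => i si; rewrite BA.
- by rewrite map_inj_uniq.
- by move=> j /mapP[i si ->]; apply: DE; exact: sD.
- by move=> j /mapP[i si ->]; rewrite BA //; exact: GA.
Qed.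

(* On the nonnegative arguments at which it is used, Num.truncn is the floor
   function with values in nat. *)
Theorem theorem1p1 (R : realType) (L T delta : R)
  (L_gt0 : 0 < L) (T_gt0 : 0 < T) (delta_gt0 : 0 < delta)
  (f : R -> R) (f_cont : continuous f)
  (f_lip : forall a b : R, `|f a - f b| <= L * `|a - b|)
  (disp : measure_display) (Omega : measurableType disp)
  (P : probability Omega R)
  (r : Theta -> Omega -> R)
  (r_meas : forall theta, measurable_fun [set: Omega] (r theta))
  (r_range : forall theta w, 0 < r theta w < 1)
  (r_indep : mutually_independent P [set: Theta]
     (fun theta => sigma_rv [set: unit] (fun _ => r theta)))
  (r_ident : forall (theta theta' : Theta) (B : set R), measurable B ->
     P [set w | B (r theta w)] = P [set w | B (r theta' w)])
  (r_unif : forall t : R, 0 < t < 1 -> P [set w | r theta0 w <= t] = t%:E)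
  (W : forall d : nat, Theta -> R -> Omega -> 'rV[R]_d)
  (W_brownian : forall (d : nat) (theta : Theta), (0 < d)%N ->
     is_brownian_motion P T (W d theta))
  (W_indep : mutually_independent P [set dt : nat * Theta | (0 < dt.1)%N]
     (fun dt => sigma_process T (W dt.1 dt.2)))
  (r_W_indep : independent2 P (sigma_rv [set: Theta] r)
     <<s \bigcup_(dt in [set dt : nat * Theta | (0 < dt.1)%N])
           sigma_process T (W dt.1 dt.2) >>)
  (v : forall d : nat, nat -> nat -> 'rV[R]_d -> R)
  (v_cont : forall d K k : nat, (0 < d)%N -> (0 < K)%N -> (k <= K)%N ->
     continuous (v d K k))
  (v0_bound : forall (d K : nat) (x : 'rV[R]_d), (0 < d)%N -> (0 < K)%N ->
     `|v d K 0%N x| <= L)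
  (v_rec : forall (d K k : nat) (x : 'rV[R]_d), (0 < d)%N -> (0 < K)%N ->
     (1 <= k <= K)%N ->
     (v d K k x)%:E =
       'E_P[fun w => (v d K k.-1 (x + W d theta0 (T / K%:R) w)
                      + T / K%:R *
                          f (v d K k.-1 (x + W d theta0 (T / K%:R) w)))%R]%E)
  (V : forall d : nat, nat -> Theta -> nat -> nat -> nat ->
     'rV[R]_d -> Omega -> R)
  (V_rec : forall (d K M n k : nat) (theta : Theta) (x : 'rV[R]_d) (w : Omega),
     (0 < d)%N -> (0 < K)%N -> (0 < M)%N -> (k <= K)%N ->
     V d K theta k n M x w =
       (0 < n)%N%:R / M%:R ^+ n *
         (\sum_(1 <= m < (M ^ n).+1)
            (v d K 0%N (x + W d (append2 theta 0 (- m%:Z))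
                              (k%:R * T / K%:R) w)
             + k%:R * T / K%:R * f 0))
       + \sum_(1 <= j < n) k%:R * T / (K%:R * M%:R ^+ (n - j)) *
         (\sum_(1 <= m < (M ^ (n - j)).+1)
            let theta1 := append2 theta j%:Z m%:Z in
            let theta2 := append2 theta j%:Z (- m%:Z) in
            let l := Num.truncn (k%:R * r theta1 w) in
            let y := x + W d theta1 (k%:R * T / K%:R) w
                       - W d theta1 (l%:R * T / K%:R) w in
            (f (V d K theta1 l j M y w) - f (V d K theta2 l j.-1 M y w))))
  (C : nat -> nat -> nat -> nat -> nat)
  (C_rec : forall d K M n : nat, (0 < d)%N -> (0 < K)%N -> (0 < M)%N ->
     (1 <= n)%N ->
     (C d K M n <= d * M ^ n
        + \sum_(1 <= j < n)
            M ^ (n - j) * (d + 1 + C d K M j + C d K M j.-1))%N)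
  (C_0 : forall d K M : nat, (0 < d)%N -> (0 < K)%N -> (0 < M)%N ->
     (C d K M 0 <= d)%N) :
  exists (N : R -> nat) (c : R),
    forall eps : R, 0 < eps <= 1 ->
      (0 < N eps)%N /\
      forall d K : nat, (0 < d)%N -> (0 < K)%N ->
        (C d K (N eps) (N eps))%:R <= c * d%:R * eps `^ (- (2 + delta)) /\
        ('E_P[fun w =>
             (`|V d K theta0 K (N eps) (N eps) 0 w - v d K K 0| ^+ 2)%R]
           `^ (2^-1) <= eps%:E)%E.
Proof.
have growth0 : 0 < growth T L by exact: (lt_le_trans ltr01 (growth_ge1 T_gt0 L_gt0)).
(* The factor exp(T) absorbs the time weight: for M = n, (1 + n T / K)^K <= exp(T)^n, whatever K
   is. *)
have b0 : 0 < growth T L * expR T by rewrite mulr_gt0 ?expR_gt0.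
have [N [c hN]] := sample_size (amplitude_ge0 T L f) b0 delta_gt0.
exists N, c => eps eps01; have [N0 errN costN] := hN eps eps01.
have /andP[eps0 _] := eps01.
split => // d K d0 K0; split.
  have cost := @cost_le (fun n => C d K (N eps) n) d (N eps) d0 (C_0 d K (N eps) d0 K0 N0)
    (fun n n1 => C_rec d K (N eps) n d0 K0 N0 n1) N0 (N eps).
  apply: (@le_trans _ _ (d%:R * (5 * (N eps)%:R) ^+ N eps)).
    by rewrite -(natrM _ 5) -natrX -natrM ler_nat.
  by rewrite [c * _]mulrC -mulrA ler_wpM2l.
have W_indep_d : mutually_independent P [set: Theta]
    (fun theta => sigma_process T (W d theta)).
  apply: (mutually_independent_inj (phi := fun theta : Theta => (d, theta)) _ _ W_indep).
    by move=> t t' [].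
  by [].
have r_W_indep_d : independent2 P (sigma_rv [set: Theta] r)
    <<s \bigcup_theta sigma_process T (W d theta) >>.
  apply: independent2_sub r_W_indep => //.
  by apply: sub_sigma_algebra2 => B [theta _ WB]; exists (d, theta).
have v_cont_d k : (k <= K)%N -> continuous (v d K k) by exact: v_cont.
have v0_d x : `|v d K 0%N x| <= L by exact: v0_bound.
have V_rec_d n k theta x w (kK : (k <= K)%N) := V_rec d K (N eps) n k theta x w d0 K0 N0 kK.
have W_d theta := W_brownian d theta d0.
have v_rec_d k x (k1 : (1 <= k <= K)%N) := v_rec d K k x d0 K0 k1.
have err := sq_error_le T_gt0 r_meas r_range r_indep r_ident r_unif W_d W_indep_d
  r_W_indep_d K0 L_gt0 f_cont f_lip v_cont_d v0_d v_rec_d N0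
  (V := fun theta k n => V d K theta k n (N eps)) V_rec_d (N eps) theta0 0 (leqnn K).
have bV := bm_Vx T_gt0 r_meas r_range W_d K0 L_gt0 f_cont f_lip v_cont_d v0_d v_rec_d
  (V := fun theta k n => V d K theta k n (N eps)) V_rec_d (N eps) theta0 0 (leqnn K).
have bVv : bounded_measurable (fun w => (V d K theta0 K (N eps) (N eps) 0 w - v d K K 0) ^+ 2).
  by apply: bmX; apply: bmB bV _; exact: bm_cst.
rewrite unlock.
have -> : (\int[P]_w (`|V d K theta0 K (N eps) (N eps) 0 w - v d K K 0| ^+ 2)%:E)%E =
    (\int[P]_w (V d K theta0 K (N eps) (N eps) 0 w - v d K K 0) ^+ 2)%:E.
  by rewrite bm_EFin //; apply: eq_integral => w _; rewrite real_normK ?num_real.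
rewrite poweR_EFin lee_fin powR12_sqrt; last by apply: bm_int_ge0 => w; exact: sqr_ge0.
(* The root is compared with the root of eps^2, the accuracy for which the size was chosen. *)
rewrite -[leRHS](ger0_norm (ltW eps0)) -sqrtr_sqr ler_wsqrtr //.
apply: (le_trans err); apply: le_trans errN.
have -> : amplitude T L f * (growth T L * expR T / (N eps)%:R) ^+ N eps =
    rate T L f (N eps) (N eps) * expR T ^+ N eps.
  by rewrite /rate !exprMn exprVn; ring.
apply: ler_wpM2l; first exact: rate_ge0.
rewrite /time_weight.
have KR : 0 < K%:R :> R by rewrite ltr0n.
apply: (@le_trans _ _ (expR ((N eps)%:R * (T / K%:R)) ^+ K)).
  rewrite lerXn2r ?nnegrE ?expR_ge0 //; last exact: expR_ge1Dx.
  by rewrite addr_ge0 // mulr_ge0 // divr_ge0 // ltW.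
rewrite -expRM_natl -expRM_natl ler_expR.
by rewrite le_eqVlt; apply/orP; left; apply/eqP; field; rewrite gt_eqF.
Qed.
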